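(* Let $(\mathcal A,\mathcal A_* )$ be a dual Banach algebra. Then there exist a reflexive Banach space $E$ and an isometric algebra homomorphism $\pi:\mathcal A\rightarrow\mathcal B(E)$ which is weak$^*$-weak$^*$-continuous, that is, continuous from $\sigma(\mathcal A,\mathcal A_* )$ to the weak$^*$-topology of $\mathcal B(E)$.
   Context: Banach algebras have contractive product, and a unit (if there is one) has norm one. For a Banach space $E$, $E'$ is its dual and $\langle\cdot,\cdot\rangle$ the dual pairing; $\mathcal B(E)$ is the algebra of bounded linear operators on $E$. A dual Banach algebra $(\mathcal A,\mathcal A_* )$ is a Banach algebra $\mathcal A$ together with a Banach space $\mathcal A_*$ (the predual) such that $\mathcal A=(\mathcal A_* )'$ as a Banach space and the multiplication of $\mathcal A$ is separately $\sigma(\mathcal A,\mathcal A_* )$-continuous. When $E$ is reflexive, $\mathcal B(E)$ carries the weak$^*$-topology given by its canonical predual, the projective tensor product $E'\widehat\otimes E$, via $\langle T,\mu\otimes x\rangle=\langle\mu,T(x)\rangle$. *)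

(* Defs.v *)
From HB Require Import structures.
From mathcomp Require Import all_boot all_order all_algebra.
From mathcomp Require Import complex.
From mathcomp Require Import boolp classical_sets functions reals.
From mathcomp Require Import topology normedtype.

Set Implicit Arguments.
Unset Strict Implicit.
Unset Printing Implicit Defensive.

Import Order.TTheory GRing.Theory Num.Theory numFieldNormedType.Exports.

Local Open Scope classical_set_scope.
Local Open Scope ring_scope.
Local Open Scope complex_scope.

(* Banach spaces are completeNormedModType R[i] with R : realType: the scalars
   are the complex numbers, and norms are R[i]-valued (but real).  rnorm is the
   norm as an element of R, where suprema and infima are available. *)
Definition rnorm (R : realType) (V : normedModType R[i]) (x : V) : R :=
  complex.Re `|x|.

Lemma rnormE (R : realType) (V : normedModType R[i]) (x : V) :
  (rnorm x)%:C = `|x|.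
Proof. by rewrite /rnorm RRe_real// normr_real. Qed.

Section BoundedOperators.
Variables (R : realType) (E F : normedModType R[i]).

Definition bounded_linear : {pred E -> F} := fun T : E -> F =>
  `[< linear T /\ exists M : R, forall x, `|T x| <= M%:C * `|x| >].

Record bop := Bop { bop_fun :> E -> F; _ : bop_fun \in bounded_linear }.

HB.instance Definition _ := [isSub for bop_fun].
HB.instance Definition _ := [Choice of bop by <:].

Lemma bounded_linear_submod_closed : submod_closed bounded_linear.
Proof.
split=> [|a f g /asboolP[lf [M fM]] /asboolP[lg [N gN]]]; apply/asboolP; split.
- by move=> a x y; rewrite /= scaler0 addr0.
- by exists 0 => x; rewrite normr0 mul0r.
- move=> b x y; rewrite !fctE lf lg !scalerDr !scalerA (mulrC a b) -!addrA.
  by congr (_ + _); rewrite addrCA.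
- exists (rnorm (a : R[i]^o) * M + N) => x.
  rewrite !fctE (le_trans (ler_normD _ _))// normrZ rmorphD rmorphM/= mulrDl.
  by rewrite lerD// rnormE -mulrA ler_wpM2l.
Qed.

HB.instance Definition _ := GRing.isSubmodClosed.Build R[i] (E -> F)
  bounded_linear bounded_linear_submod_closed.
HB.instance Definition _ := [SubChoice_isSubLmodule of bop by <:].

Lemma bop_linear (T : bop) : linear T.
Proof. by case: T => T /= /asboolP[]. Qed.

HB.instance Definition _ (T : bop) :=
  GRing.isLinear.Build R[i] E F _ (bop_fun T) (bop_linear T).

Definition opnorm (T : bop) : R :=
  sup [set rnorm (T x) | x in [set x : E | `|x| <= 1]].

Lemma opnorm_has_sup (T : bop) :
  has_sup [set rnorm (T x) | x in [set x : E | `|x| <= 1]].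
Proof.
split; first by exists (rnorm (T 0)), 0 => //=; rewrite normr0.
case: T => T /= /asboolP[_ [M TM]]; exists (Num.max M 0) => _ [x /= x1 <-].
rewrite -lecR rnormE (le_trans (TM x))//.
have M0 : M%:C <= (Num.max M 0)%:C by rewrite lecR le_max lexx.
rewrite (le_trans (ler_wpM2r _ M0))// -[leRHS]mulr1 ler_wpM2l//.
by rewrite ler0c le_max lexx orbT.
Qed.

Lemma opnorm_ub (T : bop) x : `|x| <= 1 -> rnorm (T x) <= opnorm T.
Proof.
by move=> x1; apply: ub_le_sup; [case: (opnorm_has_sup T)|exists x].
Qed.

Lemma opnorm_lub (T : bop) (M : R) :
  (forall x, `|x| <= 1 -> rnorm (T x) <= M) -> opnorm T <= M.
Proof.
move=> TM; apply: ge_sup; first by case: (opnorm_has_sup T).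
by move=> _ [x /= x1 <-]; exact: TM.
Qed.

Lemma opnorm_ge0 (T : bop) : 0 <= opnorm T.
Proof.
have le01 : `|0 : E| <= 1 by rewrite normr0.
by rewrite (le_trans _ (opnorm_ub T le01))// -ler0c rnormE.
Qed.

Lemma bopDE (T S : bop) x : (T + S) x = T x + S x. Proof. by []. Qed.
Lemma bopZE (a : R[i]) (T : bop) x : (a *: T) x = a *: T x. Proof. by []. Qed.

Lemma opnormD (T S : bop) : (opnorm (T + S))%:C <= (opnorm T)%:C + (opnorm S)%:C.
Proof.
rewrite -rmorphD lecR; apply: opnorm_lub => x x1.
rewrite -lecR rnormE bopDE (le_trans (ler_normD _ _))// rmorphD.
by rewrite lerD// -rnormE lecR opnorm_ub.
Qed.

Let opnormZ_le (a : R[i]) (T : bop) :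
  (opnorm (a *: T))%:C <= `|a| * (opnorm T)%:C.
Proof.
rewrite -(rnormE (a : R[i]^o)) -rmorphM lecR; apply: opnorm_lub => x x1.
rewrite -lecR rnormE bopZE normrZ rmorphM/= rnormE ler_wpM2l//.
by rewrite -rnormE lecR opnorm_ub.
Qed.

Lemma opnormZ (a : R[i]) (T : bop) :
  (opnorm (a *: T))%:C = `|a| * (opnorm T)%:C.
Proof.
have [->|a0] := eqVneq a 0.
  apply/eqP; rewrite eq_le opnormZ_le normr0 mul0r.
  by rewrite ler0c opnorm_ge0.
apply/eqP; rewrite eq_le opnormZ_le/=.
rewrite -ler_pdivlMl ?normr_gt0// -normfV.
by rewrite (le_trans _ (opnormZ_le _ _))// scalerA mulVf// scale1r.
Qed.

Lemma opnorm_eq0 (T : bop) : (opnorm T)%:C = 0 -> T = 0.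
Proof.
move=> T0; apply/val_inj/funext => x; rewrite [RHS]/=.
have [->|x0] := eqVneq x 0; first exact: linear0.
apply/eqP; rewrite -normr_le0.
have nx : `| (`|x|)^-1 *: x| <= 1.
  by rewrite normrZ normfV normr_id mulVf// normr_eq0.
have := opnorm_ub T nx.
rewrite -lecR T0 rnormE linearZ normrZ normfV normr_id.
by rewrite pmulr_rle0// invr_gt0 normr_gt0.
Qed.

HB.instance Definition _ := Lmodule_isNormed.Build R[i] bop
  opnormD opnormZ opnorm_eq0.

End BoundedOperators.

Notation "''B' ( E )" := (bop E E) (at level 8, format "''B' ( E )").

Definition dual (R : realType) (E : normedModType R[i]) := bop E R[i]^o.

Definition reflexive_space (R : realType) (E : normedModType R[i]) :=
  forall Phi : dual (dual E), exists x : E, forall mu : dual E, Phi mu = mu x.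

(* The initial topology on X for a family of scalar functions indexed by I. *)
Definition sigma_topology (R : realType) (X I : Type) (ev : X -> I -> R[i]) :=
  initial_topology (ev : X -> {ptws I -> R[i]^o}).

Section ProjectiveTensor.
Variables (R : realType) (V W : normedModType R[i]).

(* The finite sequence [:: (v1, w1); ...; (vn, wn)] represents the element
   v1 (x) w1 + ... + vn (x) wn of the algebraic tensor product. *)
Definition tensor_rep := seq (V * W).

(* Equality in the algebraic tensor product, by its universal property. *)
Definition tensor_eq (s t : tensor_rep) :=
  forall (U : lmodType R[i]) (b : {bilinear V -> W -> U}),
    \sum_(p <- s) b p.1 p.2 = \sum_(p <- t) b p.1 p.2.

Definition tensor_sub (s t : tensor_rep) : tensor_rep :=
  s ++ [seq (- p.1, p.2) | p <- t].

Definition proj_norm (s : tensor_rep) : R :=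
  inf [set \sum_(p <- t) rnorm p.1 * rnorm p.2 | t in [set t | tensor_eq s t]].

(* The completion for proj_norm, presented by Cauchy sequences; sequences with
   the same limit are not identified. *)
Record proj_tensor := ProjTensor {
  proj_seq :> nat -> tensor_rep;
  _ : forall e : R, 0 < e -> exists N, forall m n, (N <= m)%N -> (N <= n)%N ->
        proj_norm (tensor_sub (proj_seq m) (proj_seq n)) < e }.

End ProjectiveTensor.

(* <T, u> for u in the completed projective tensor product of E' and E: the
   continuous extension of <T, mu (x) x> = <mu, T x>. *)
Definition trace_pairing (R : realType) (E : normedModType R[i])
    (T : 'B(E)) (u : proj_tensor (dual E) E) : R[i] :=
  lim ((fun n => \sum_(p <- u n) p.1 (T p.2) : R[i]^o) @ \oo).

(* B(E) with its weak-star topology, for E reflexive. *)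
Definition weak_star_op (R : realType) (E : normedModType R[i]) :=
  sigma_topology (@trace_pairing R E).

(* Algebras need not be unital.  The condition e != 0 on the unit is automatic
   unless A = 0, so that the zero algebra is a Banach algebra. *)
Record banach_algebra (R : realType) (A : completeNormedModType R[i])
    (mul : A -> A -> A) : Prop := {
  ba_linl : forall b, linear (mul^~ b);
  ba_linr : forall a, linear (mul a);
  ba_assoc : associative mul;
  ba_contractive : forall a b, `|mul a b| <= `|a| * `|b|;
  ba_unit : forall e, left_id e mul -> right_id e mul -> e != 0 -> `|e| = 1 }.

(* sigma(A, Astar) for a given pairing of A with Astar. *)
Definition weak_star (R : realType) (A Astar : normedModType R[i])
  (pair : A -> dual Astar) := sigma_topology (fun a phi => pair a phi).

(* The identification of A with the dual of Astar is the isometric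
   isomorphism pair. *)
Record dual_banach_algebra (R : realType) (A Astar : completeNormedModType R[i])
    (mul : A -> A -> A) (pair : A -> dual Astar) : Prop := {
  dba_algebra : banach_algebra mul;
  dba_linear : linear pair;
  dba_isometric : forall a, `|pair a| = `|a|;
  dba_surjective : forall f : dual Astar, exists a, pair a = f;
  dba_continuousl :
    forall b, continuous (mul^~ b : weak_star pair -> weak_star pair);
  dba_continuousr :
    forall a, continuous (mul a : weak_star pair -> weak_star pair) }.

(* Main.v *)
Require Import Defs.
From HB Require Import structures.
From mathcomp Require Import all_boot all_order all_algebra.
From mathcomp Require Import complex.
From mathcomp Require Import boolp classical_sets functions reals.
From mathcomp Require Import topology normedtype.
From mathcomp Require Import ring lra.
Import Order.TTheory GRing.Theory Num.Theory numFieldNormedType.Exports.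
Local Open Scope classical_set_scope.
Local Open Scope ring_scope.
Local Open Scope complex_scope.

(** Let X be the predual of the unitization of A, that is Astar * C.  The algebra
    acts on X from the left by contractions, L a (phi, t) = (a . phi, <a, phi>).
    For mu in Astar put m = (mu, 0).  Since the product of A is separately
    weak-star continuous, b |-> xi (L b m) is given by an element of Astar for
    every xi in X'; hence the transpose of the orbit map of m is a map T_mu from
    X' to X.  In particular the orbit of m under the unit ball is relatively
    weakly compact, and interpolation between X and this orbit, in the manner of
    Davis, Figiel, Johnson and Pelczynski, produces a reflexive space.

    The interpolation is carried out in dual form, so that the Hahn-Banach
    theorem replaces all arguments on weakly compact sets.  On X' put
    p_(mu,n) (xi) = 2^n |T_mu xi| + 2^-n |xi|, and let |.|_(mu,n) be the dual norm
    on X.  The space E consists of the families (x_mu) of points of X, indexed by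
    Astar, for which the sum of the squares of all |x_mu|_(mu,n) is finite, and A
    acts on E through L in each coordinate.

    E is reflexive.  The functionals x |-> xi (x_mu) span a dense subspace of E'
    ([coord_dense]), so an element Phi of E'' is determined by the functionals
    xi |-> Phi (x |-> xi (x_mu)) on X'.  Such a functional is dominated by
    |Phi| p_(mu,n) for each n, so it is the sum of one that factors through T_mu,
    which is evaluation at a point of X, and one of norm at most |Phi| 2^-n.  As
    X is closed in its bidual, it is evaluation at a point x_mu
    ([bidual_coord]); and (x_mu) belongs to E because the weights are dual norms
    ([bidual_partial_norm]).

    The representation is contractive because L a multiplies each weight by at
    most |a| ([orbit_contraction]).  It is isometric because, for |mu| <= 1, the
    vector m placed at mu and the functional (phi, t) |-> t of the coordinate mu
    have the matrix coefficient <a, mu> and norms whose product is at most 1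
    ([rep_lower_bound]).

    Finally, the matrix coefficients of the coordinate functionals are elements
    of Astar.  By density and completeness of Astar so are all matrix
    coefficients, and so are the pairings with elements of the projective tensor
    product, which are limits of sums of matrix coefficients uniformly on bounded
    sets ([trace_in_predual]). *)

Set Implicit Arguments.
Unset Strict Implicit.
Unset Printing Implicit Defensive.

(** * Real-valued norms *)

Lemma realC_inj (R : realType) (x y : R) : x%:C = y%:C -> x = y.
Proof. exact: complexI. Qed.

Section Scalars.
Variable R : realType.
Implicit Types a b : R[i].

Definition cabs a : R := rnorm (a : R[i]^o).

Lemma cabsE a : (cabs a)%:C = `|a|.
Proof. exact: (@rnormE R R[i]^o). Qed.

Lemma cabsM a b : cabs (a * b) = cabs a * cabs b.
Proof. by apply: realC_inj; rewrite cabsE rmorphM/= !cabsE normrM. Qed.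

Lemma cabsD a b : cabs (a + b) <= cabs a + cabs b.
Proof. by rewrite -lecR rmorphD/= !cabsE ler_normD. Qed.

Lemma cabsN a : cabs (- a) = cabs a.
Proof. by apply: realC_inj; rewrite !cabsE normrN. Qed.

Lemma cabs_ge0 a : 0 <= cabs a.
Proof. by rewrite -ler0c cabsE. Qed.

Lemma cabs0 : cabs 0 = 0.
Proof. by apply: realC_inj; rewrite cabsE normr0. Qed.

Lemma cabsR (t : R) : 0 <= t -> cabs t%:C = t.
Proof. by move=> t0; apply: realC_inj; rewrite cabsE ger0_norm// ler0c. Qed.

Lemma cabs1 : cabs 1 = 1.
Proof. by apply: realC_inj; rewrite cabsE normr1. Qed.

Lemma cabs_eq0 a : cabs a = 0 -> a = 0.
Proof. by move=> h; apply/eqP; rewrite -normr_eq0 -cabsE h. Qed.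

Lemma normRe_le_cabs a : `|complex.Re a| <= cabs a.
Proof. by rewrite -lecR cabsE normc_ge_Re. Qed.

Lemma Re_le_cabs a : complex.Re a <= cabs a.
Proof. exact: le_trans (ler_norm _) (normRe_le_cabs a). Qed.

Lemma cabs_real (t : R) : cabs t%:C = `|t|.
Proof.
by apply: realC_inj; rewrite cabsE normc_def/= expr0n addr0 sqrtr_sqr.
Qed.

Lemma cabsi : cabs ('i : R[i]) = 1.
Proof.
by apply: realC_inj; rewrite cabsE normc_def/= expr0n add0r expr1n sqrtr1.
Qed.

Lemma normIm_le_cabs a : `|complex.Im a| <= cabs a.
Proof.
rewrite -[complex.Im a]opprK -ReiNIm normrN (le_trans (normRe_le_cabs _))//.
by rewrite cabsM cabsi mulr1.
Qed.

Lemma cabs_sum (I : Type) (s : seq I) (u : I -> R[i]) :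
  cabs (\sum_(i <- s) u i) <= \sum_(i <- s) cabs (u i).
Proof.
elim: s => [|i s IH]; first by rewrite !big_nil cabs0.
by rewrite !big_cons (le_trans (cabsD _ _))// lerD.
Qed.

Lemma phaseP a : exists2 c, cabs c = 1 & c * a = (cabs a)%:C.
Proof.
have [->|a0] := eqVneq a 0.
  by exists 1; rewrite ?cabs1// mul1r cabs0.
have na : `|a| != 0 by rewrite normr_eq0.
exists (`|a| / a); last by rewrite divfK// cabsE.
by apply: realC_inj; rewrite cabsE normrM normfV normr_id divff.
Qed.

Lemma rnormZ (V : normedModType R[i]) a (v : V) :
  rnorm (a *: v) = cabs a * rnorm v.
Proof. by apply: realC_inj; rewrite rmorphM/= cabsE !rnormE normrZ. Qed.

Lemma rnormD (V : normedModType R[i]) (u v : V) :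
  rnorm (u + v) <= rnorm u + rnorm v.
Proof. by rewrite -lecR rmorphD/= !rnormE ler_normD. Qed.

Lemma rnorm_ge0 (V : normedModType R[i]) (v : V) : 0 <= rnorm v.
Proof. by rewrite -ler0c rnormE. Qed.

Lemma rnormN (V : normedModType R[i]) (v : V) : rnorm (- v) = rnorm v.
Proof. by apply: realC_inj; rewrite !rnormE normrN. Qed.

Lemma rnorm0 (V : normedModType R[i]) : rnorm (0 : V) = 0.
Proof. by apply: realC_inj; rewrite !rnormE normr0. Qed.

Lemma rnorm_eq0 (V : normedModType R[i]) (v : V) : rnorm v = 0 -> v = 0.
Proof. by move=> h; apply/eqP; rewrite -normr_eq0 -rnormE h. Qed.

Lemma rnorm_lt (V : normedModType R[i]) (v : V) (e : R) :
  (rnorm v < e) = (`|v| < e%:C).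
Proof. by rewrite -rnormE ltcR. Qed.

Lemma rnorm_le (V : normedModType R[i]) (v : V) (e : R) :
  (rnorm v <= e) = (`|v| <= e%:C).
Proof. by rewrite -rnormE lecR. Qed.

End Scalars.

Definition mk_linear (K : pzRingType) (U V : lmodType K) (f : U -> V)
    (fL : linear f) : {linear U -> V} :=
  HB.pack f (GRing.isLinear.Build _ _ _ _ f fL).

(** * The Hahn-Banach theorem *)

Section HahnBanach.
Variable R : realType.

(** The scalars are complex but only positive real ones act, so that the real
    and the complex extension theorems can share the same underlying spaces. *)
Definition sublinear (V : lmodType R[i]) (p : V -> R) :=
  (forall x y, p (x + y) <= p x + p y) /\
  (forall t x, 0 < t -> p (t%:C *: x) <= t * p x).

Definition seminorm (V : lmodType R[i]) (p : V -> R) :=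
  (forall x y, p (x + y) <= p x + p y) /\
  (forall a x, p (a *: x) <= cabs a * p x).

Section Real.
Variable V : lmodType R[i].
Implicit Types p q : V -> R.

Lemma sublinear0 p : sublinear p -> p 0 = 0.
Proof.
move=> [pD pZ]; have := pD 0 0; rewrite addr0 => h1.
have := pZ 2^-1 0; rewrite scaler0 => /(_ _); rewrite invr_gt0 => /(_ (ltr0Sn _ _)).
lra.
Qed.

Lemma sublinearZ p t x : sublinear p -> 0 <= t -> p (t%:C *: x) = t * p x.
Proof.
move=> pS; have [pD pZ] := pS; rewrite le_eqVlt => /predU1P[<-|t0].
  by rewrite scale0r mul0r sublinear0.
apply/eqP; rewrite eq_le pZ//=.
rewrite -ler_pdivlMl//; have := pZ t^-1 (t%:C *: x).
rewrite invr_gt0 => /(_ t0); rewrite scalerA -rmorphM/= mulVf ?gt_eqF//.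
by rewrite scale1r.
Qed.

Lemma sublinearN p x : sublinear p -> - p (- x) <= p x.
Proof.
move=> pS; have [pD _] := pS; have := pD x (- x).
by rewrite subrr (sublinear0 pS); lra.
Qed.

(** The directions [L a] form a convex cone on which [u] is sublinear, hence so is
    the infimal convolution [q]; the last hypothesis keeps the infimum finite.
    Directions along a half-line turn a sublinear
    functional into a smaller one, directions along a subspace force an
    extension to have prescribed values there. *)
Lemma sublinear_inf (T : Type) (A : set T) (L : T -> V) (u : T -> R) p :
  sublinear p -> A !=set0 ->
  (forall a b, A a -> A b -> exists c, [/\ A c, L c = L a + L b & u c <= u a + u b]) ->
  (forall t a, 0 < t -> A a ->
     exists c, [/\ A c, L c = t%:C *: L a & u c <= t * u a]) ->
  (forall a, A a -> - p (L a) <= u a) ->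
  let q x := inf [set p (x + L a) + u a | a in A] in
  sublinear q /\ forall x a, A a -> q x <= p (x + L a) + u a.
Proof.
move=> pS [a0 Aa0] AD AZ Ap q; have [pD pZ] := pS.
have lb x : has_lbound [set p (x + L a) + u a | a in A].
  exists (- p (- x)) => _ [a Aa <-].
  have := pD (x + L a) (- x); rewrite addrAC subrr add0r => h.
  have := Ap _ Aa; lra.
have qle x a : A a -> q x <= p (x + L a) + u a.
  by move=> Aa; apply: ge_inf => //; exists a.
have glb_le x m : (forall a, A a -> m <= p (x + L a) + u a) -> m <= q x.
  move=> h; apply: lb_le_inf; first by exists (p (x + L a0) + u a0), a0.
  by move=> _ [a Aa <-]; exact: h.
split=> //; split=> [x y|t x t0].
  rewrite -lerBlDr; apply: (glb_le) => a Aa.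
  rewrite lerBlDr -lerBlDl; apply: (glb_le) => b Ab.
  have [c [Ac Lc uc]] := AD _ _ Aa Ab.
  have := qle (x + y) c Ac; rewrite Lc addrACA.
  have := pD (x + L a) (y + L b); lra.
rewrite -ler_pdivrMl//; apply: (glb_le) => a Aa.
rewrite ler_pdivrMl//; have [c [Ac Lc uc]] := AZ _ _ t0 Aa.
rewrite (le_trans (qle _ _ Ac))// Lc -scalerDr.
by have := pZ t (x + L a) t0; lra.
Qed.

Definition real_linear (g : V -> R) :=
  (forall x y, g (x + y) = g x + g y) /\ (forall t x, g (t%:C *: x) = t * g x).

(** Zorn's lemma for the pointwise order reversed: the pointwise infimum of a
    chain of sublinear functionals below [p] is finite because each of them is
    bounded below by [x |-> - p (- x)]. *)
Lemma minimal_sublinear p : sublinear p ->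
  exists2 q, sublinear q & (forall x, q x <= p x) /\
    forall q', sublinear q' -> (forall x, q' x <= q x) -> q' = q.
Proof.
move=> pS; pose T := {q : V -> R | sublinear q /\ forall x, q x <= p x}.
pose r (s t : T) := `[< forall x, sval t x <= sval s x >].
have [||||[q [qS qp]] qmin] := @Zorn T r.
- by move=> t; apply/asboolP.
- move=> a b c /asboolP ab /asboolP bc; apply/asboolP => x.
  exact: le_trans (bc x) (ab x).
- move=> [a Pa] [b Pb] /asboolP/= ab /asboolP/= ba; apply: eq_exist => /=.
  by apply/funext => x; apply/eqP; rewrite eq_le ab ba.
- move=> A Atot; have [[a0 Aa0]|/set0P/negP/negPn/eqP A0] := pselect (A !=set0); last first.
    have pp : sublinear p /\ forall x, p x <= p x by [].
    by exists (exist _ p pp) => s; rewrite A0.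
  pose q x := inf [set sval a x | a in A].
  have lb x : has_lbound [set sval a x | a in A].
    exists (- p (- x)) => _ [[a [aS ap]] Aa <-] /=.
    by rewrite (le_trans _ (sublinearN x aS))// lerN2.
  have qle x a : A a -> q x <= sval a x.
    by move=> Aa; apply: ge_inf => //; exists a.
  have glb_le x m : (forall a, A a -> m <= sval a x) -> m <= q x.
    move=> h; apply: lb_le_inf; first by exists (sval a0 x), a0.
    by move=> _ [a Aa <-]; exact: h.
  have qS : sublinear q /\ forall x, q x <= p x.
    split; last by move=> x; rewrite (le_trans (qle x _ Aa0))//; case: (svalP a0).
    split=> [x y|t x t0].
      rewrite -lerBlDr; apply: (glb_le) => a Aa.
      rewrite lerBlDr -lerBlDl; apply: (glb_le) => b Ab.
      have [[aD _] _] := svalP a; have [[bD _] _] := svalP b.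
      have [/asboolP ab|/asboolP ba] := Atot _ _ Aa Ab.
        by have := qle (x + y) _ Ab; have := bD x y; have := ab x; lra.
      by have := qle (x + y) _ Aa; have := aD x y; have := ba y; lra.
    rewrite -ler_pdivrMl//; apply: (glb_le) => a Aa; rewrite ler_pdivrMl//.
    by rewrite (le_trans (qle _ _ Aa))//; case: (svalP a) => -[_ ->].
  exists (exist _ q qS) => s As; apply/asboolP => x; exact: qle.
exists q => //; split=> // q' q'S q'q.
have P' : sublinear q' /\ forall x, q' x <= p x.
  by split=> // x; exact: le_trans (q'q x) (qp x).
have := qmin (exist _ q' P'); move=> /(_ _)/(congr1 sval)/= -> //.
exact/asboolP.
Qed.

(** A minimal sublinear functional is linear: replacing [q y] by the infimum of
    [q (y + t x) - t q x] over [t >= 0] cannot lower it, and [t = 1], [y = - x]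
    then gives [q (- x) <= - q x]. *)
Lemma sublinear_real_linear p : sublinear p ->
  exists2 g, real_linear g & forall x, g x <= p x.
Proof.
move=> /minimal_sublinear[q qS [qp qmin]]; exists q => //.
have [qD qZ] := qS.
have qN x : q (- x) = - q x.
  have [||||q'S q'le] := @sublinear_inf R [set t | 0 <= t]
    (fun t => t%:C *: x) (fun t => - (t * q x)) q qS.
  - by exists 0 => /=.
  - move=> a b /= a0 b0; exists (a + b); split=> /=; first exact: addr_ge0.
      by rewrite rmorphD scalerDl.
    by rewrite mulrDl opprD.
  - move=> t a /= t0 a0; exists (t * a); split=> /=.
    + by rewrite mulr_ge0// ltW.
    + by rewrite rmorphM scalerA.
    + by rewrite mulrN mulrA.
  - by move=> t /= t0; rewrite -sublinearZ.
  have q'q y : inf [set q (y + a%:C *: x) - a * q x | a in [set t | 0 <= t]] <= q y.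
    by have := q'le y 0 (lexx 0); rewrite scale0r addr0 mul0r subr0.
  have /(congr1 (@^~ (- x)))/= qx := qmin _ q'S q'q.
  have := q'le (- x) 1 ler01; rewrite qx scale1r addNr.
  by rewrite (sublinear0 qS); have := sublinearN x qS; lra.
split=> [x y|t x].
  have := qD x y; have := qD (- x) (- y); rewrite -opprD !qN; lra.
have [t0|t0] := leP 0 t; first exact: sublinearZ.
by rewrite -[t]opprK rmorphN scaleNr qN sublinearZ ?oppr_ge0 ?ltW// !mulNr.
Qed.

End Real.

(** A linear functional below the infimal convolution of [p] with [- f] along the
    range of [L] is below [p] and agrees with [f] through [L].  Extending along a
    map rather than from a subspace includes the factorization of [f] through
    [L]. *)
Lemma real_hahn_banach (V W : lmodType R[i]) (L : {linear V -> W})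
    (f : V -> R) (p : W -> R) :
  sublinear p -> real_linear f -> (forall v, f v <= p (L v)) ->
  exists g, [/\ real_linear g, (forall w, g w <= p w) & forall v, g (L v) = f v].
Proof.
move=> pS [fD fZ] fp.
have f0 : f 0 = 0 by have := fD 0 0; rewrite addr0; lra.
have fN v : f (- v) = - f v by have := fD v (- v); rewrite subrr f0; lra.
have [||||qS qle] := @sublinear_inf W V setT (fun v => L v) (fun v => - f v) p pS.
- by exists 0.
- by move=> a b _ _; exists (a + b); rewrite linearD fD opprD.
- by move=> t a _ _; exists (t%:C *: a); rewrite linearZ fZ mulrN.
- by move=> v _; rewrite lerN2.
have [g gL gq] := sublinear_real_linear qS; exists g; have [gD gZ] := gL.
have g0 : g 0 = 0 by have := gD 0 0; rewrite addr0; lra.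
have gN w : g (- w) = - g w by have := gD w (- w); rewrite subrr g0; lra.
split=> // [w|v].
  by have := le_trans (gq w) (qle w 0 I); rewrite linear0 addr0 f0 subr0.
have gf u : - g (L u) <= - f u.
  have := le_trans (gq (- L u)) (qle (- L u) u I).
  by rewrite addNr (sublinear0 pS) add0r gN.
by have := gf v; have := gf (- v); rewrite linearN gN fN; lra.
Qed.

Lemma seminorm_sublinear (V : lmodType R[i]) (p : V -> R) :
  seminorm p -> sublinear p.
Proof. by move=> [pD pZ]; split=> // t x t0; rewrite -{2}(cabsR (ltW t0)). Qed.

(** The real part of [f] extends, and a complex functional [h] is recovered from
    its real part [g] as [h w = g w - i g (i w)]; a rotation of the argument
    turns the bound on [g] into one on the modulus of [h]. *)
Lemma hahn_banach (V W : lmodType R[i]) (L : {linear V -> W})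
    (f : {linear V -> R[i]^o}) (p : W -> R) :
  seminorm p -> (forall v, cabs (f v) <= p (L v)) ->
  exists g : {linear W -> R[i]^o},
    (forall w, cabs (g w) <= p w) /\ forall v, g (L v) = f v.
Proof.
move=> pS fp; have [pD pZ] := pS.
have fL : real_linear (fun v => complex.Re (f v)).
  split=> [x y|t x]; first by rewrite linearD raddfD.
  rewrite linearZ/=; case: (f x) => a b; rewrite /GRing.scale/=; ring.
have [|g [[gD gZ] gp gf]] := real_hahn_banach (seminorm_sublinear pS) fL (L := L).
  by move=> v; exact: le_trans (Re_le_cabs _) (fp v).
pose h w : R[i]^o := g w +i* - g ('i *: w).
have hL : linear h.
  move=> [x y] w w'.
  have aE : (x +i* y) *: w = x%:C *: w + y%:C *: ('i *: w).
    by rewrite scalerA -scalerDl; congr (_ *: _); rewrite [LHS]complexE mulrC.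
  have aiE : 'i *: ((x +i* y) *: w) = x%:C *: ('i *: w) + (- y)%:C *: w.
    rewrite !scalerA -scalerDl; congr (_ *: _); apply/eqP.
    by rewrite eq_complex/=; apply/andP; split; apply/eqP; ring.
  rewrite /h scalerDr !gD aiE aE !gD !gZ /GRing.scale/=; apply/eqP.
  by rewrite eq_complex/=; apply/andP; split; apply/eqP; ring.
exists (mk_linear hL); split=> [w|v]; last first.
  rewrite /= /h gf -linearZ gf linearZ/=; case: (f v) => a b.
  by rewrite /GRing.scale/=; congr (_ +i* _); ring.
have [c c1 cw] := phaseP (h w).
have : h (c *: w) = (cabs (h w))%:C by rewrite -cw (scalable_linear hL).
move=> /(congr1 (@complex.Re R))/= <-.
by rewrite (le_trans (gp _))// (le_trans (pZ _ _))// c1 mul1r.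
Qed.

End HahnBanach.

Section HahnBanachSum.
Variables (R : realType) (V : lmodType R[i]).

(** Extending [f] from the diagonal of [V * V] splits it into two functionals,
    each dominated by one of the two seminorms. *)
Lemma hahn_banach_sum (f : {linear V -> R[i]^o}) (p q : V -> R) :
  seminorm p -> seminorm q -> (forall v, cabs (f v) <= p v + q v) ->
  exists g h : {linear V -> R[i]^o},
    [/\ forall v, cabs (g v) <= p v, forall v, cabs (h v) <= q v &
        forall v, f v = g v + h v].
Proof.
move=> [pD pZ] [qD qZ] fpq.
have diagL : linear (fun v : V => (v, v) : (V * V)%type) by move=> a x y.
have p0 : p 0 = 0 by have := pZ 0 0; have := pD 0 0; rewrite addr0 scale0r cabs0; lra.
have q0 : q 0 = 0 by have := qZ 0 0; have := qD 0 0; rewrite addr0 scale0r cabs0; lra.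
have [||k [kpq kf]] := @hahn_banach R V (V * V)%type (mk_linear diagL) f (fun w => p w.1 + q w.2).
- split=> [x y|a x] /=; first by have := pD x.1 y.1; have := qD x.2 y.2; lra.
  by rewrite mulrDr lerD.
- by [].
have gL : linear (fun v => k (v, 0)).
  move=> a x y; rewrite -linearP; congr (k _).
  by congr pair; rewrite /= ?scaler0 ?addr0.
have hL : linear (fun v => k (0, v)).
  move=> a x y; rewrite -linearP; congr (k _).
  by congr pair; rewrite /= ?scaler0 ?addr0.
exists (mk_linear gL).
exists (mk_linear hL).
split=> v /=; first by rewrite (le_trans (kpq _))//= q0 addr0.
  by rewrite (le_trans (kpq _))//= p0 add0r.
rewrite -kf/= -linearD; congr (k _).
by congr pair; rewrite /= ?add0r ?addr0.
Qed.

Lemma seminorm_sum (I : Type) (s : seq I) (p : I -> V -> R) :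
  (forall i, seminorm (p i)) -> seminorm (fun v => \sum_(i <- s) p i v).
Proof.
move=> pS; split=> [x y|a x].
  by rewrite -big_split/=; apply: ler_sum => i _; have [] := pS i.
by rewrite mulr_sumr; apply: ler_sum => i _; have [] := pS i.
Qed.

Lemma seminormD (p q : V -> R) :
  seminorm p -> seminorm q -> seminorm (fun v => p v + q v).
Proof.
move=> [pD pZ] [qD qZ]; split=> [x y|a x].
  by have := pD x y; have := qD x y; lra.
by rewrite mulrDr lerD.
Qed.

Lemma seminormZ (t : R) (p : V -> R) :
  0 <= t -> seminorm p -> seminorm (fun v => t * p v).
Proof.
move=> t0 [pD pZ]; split=> [x y|a x]; first by rewrite -mulrDr ler_wpM2l.
by rewrite mulrCA ler_wpM2l.
Qed.

Lemma seminorm_ge0 (p : V -> R) v : seminorm p -> 0 <= p v.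
Proof.
move=> [pD pZ]; have := pD v (- v); rewrite subrr.
have := pZ (-1) v; rewrite scaleN1r cabsN cabs1 mul1r.
have := pZ 2 0; have := pD 0 0; rewrite addr0 scaler0.
have := pZ 0 v; rewrite scale0r cabs0 mul0r; lra.
Qed.

(** How domination turns into approximation: if the functionals dominated by the
    individual [p i] lie in a class [S] closed under sums, then a functional
    dominated by finitely many of them plus [q] is within [q] of [S]. *)
Lemma hahn_banach_span (S : (V -> R[i]) -> Prop) (I : Type) (s : seq I)
    (p : I -> V -> R) (q : V -> R) (f : {linear V -> R[i]^o}) :
  S (fun=> 0) -> (forall g h, S g -> S h -> S (fun v => g v + h v)) ->
  (forall i (g : {linear V -> R[i]^o}), (forall v, cabs (g v) <= p i v) -> S g) ->
  (forall i, seminorm (p i)) -> seminorm q ->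
  (forall v, cabs (f v) <= \sum_(i <- s) p i v + q v) ->
  exists g h : {linear V -> R[i]^o},
    [/\ S g, forall v, cabs (h v) <= q v & forall v, f v = g v + h v].
Proof.
move=> S0 SD Sp pS qS; elim: s f => [|i s IH] f fs.
  exists (\0 : {linear V -> R[i]^o}), f; split=> // v.
    by rewrite (le_trans (fs v))// big_nil add0r.
  by rewrite add0r.
have [|g [h [gp hq fE]]] := @hahn_banach_sum f (p i)
  (fun v => \sum_(i <- s) p i v + q v) (pS i)
  (seminormD (seminorm_sum s pS) qS).
  by move=> v; rewrite (le_trans (fs v))// big_cons addrA.
have [g' [h' [Sg' h'q hE]]] := IH _ hq.
exists (g \+ g' : {linear V -> R[i]^o}), h'; split=> [|//|v].
  exact: SD (Sp i g gp) Sg'.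
by rewrite fE hE addrA.
Qed.

End HahnBanachSum.

(** * Bounded operators and duals *)

Section BoundedOps.
Variable R : realType.
Implicit Types E F G : normedModType R[i].

Lemma rnorm_seminorm E : seminorm (@rnorm R E).
Proof. by split=> [x y|a x]; rewrite ?rnormD ?rnormZ. Qed.

Lemma bop_exists E F (f : {linear E -> F}) (K : R) :
  (forall x, rnorm (f x) <= K * rnorm x) ->
  exists T : bop E F, forall x, T x = f x.
Proof.
move=> fK; have fb : (f : E -> F) \in @bounded_linear R E F.
  apply/asboolP; split; first exact: linearP.
  by exists K => x; rewrite -rnormE -[X in _ * X]rnormE -rmorphM/= lecR.
by exists (Bop fb).
Qed.

Lemma rnorm_bop E F (T : bop E F) : rnorm T = opnorm T.
Proof. by []. Qed.

Lemma bop_le E F (T : bop E F) x : rnorm (T x) <= rnorm T * rnorm x.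
Proof.
have [/rnorm_eq0->|x0] := eqVneq (rnorm x) 0; first by rewrite linear0 !rnorm0 mulr0.
have xp : 0 < rnorm x by rewrite lt_neqAle eq_sym x0 rnorm_ge0.
have /(opnorm_ub T) : `|(rnorm x)^-1%:C *: x| <= 1.
  rewrite -(rnorm_le _ 1) rnormZ cabsR ?invr_ge0 ?rnorm_ge0//.
  by rewrite mulVf.
rewrite linearZ/= rnormZ cabsR ?invr_ge0 ?rnorm_ge0//.
by rewrite ler_pdivrMl// mulrC.
Qed.

Lemma bop_norm_le E F (T : bop E F) (K : R) : 0 <= K ->
  (forall x, rnorm (T x) <= K * rnorm x) -> rnorm T <= K.
Proof.
move=> K0 TK; apply: opnorm_lub => x; rewrite -(rnorm_le _ 1) => x1.
by rewrite (le_trans (TK x))// ler_piMr.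
Qed.

Lemma bop_sumE E F (I : Type) (s : seq I) (u : I -> bop E F) x :
  (\sum_(i <- s) u i) x = \sum_(i <- s) u i x.
Proof. exact: (big_morph (fun f : bop E F => f x)). Qed.

Lemma bop_comp E F G (S : bop F G) (U : bop E F) :
  exists V : bop E G, forall x, V x = S (U x).
Proof.
have Vl : linear (fun x => S (U x)) by move=> a x y; rewrite !linearP.
have [|V VE] := @bop_exists E G (mk_linear Vl) (rnorm S * rnorm U).
  move=> x; rewrite (le_trans (bop_le _ _))// -mulrA ler_wpM2l ?rnorm_ge0//.
  exact: bop_le.
by exists V.
Qed.

Lemma norming E (x : E) :
  exists f : dual E, (forall y, cabs (f y) <= rnorm y) /\ f x = (rnorm x)%:C.
Proof.
have LL : linear (fun c : R[i]^o => c *: x).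
  by move=> a b c; rewrite scalerDl scalerA.
have fL : linear (fun c : R[i]^o => c * (rnorm x)%:C : R[i]^o).
  by move=> a b c; rewrite mulrDl /GRing.scale/= mulrA.
have [|g [gp gf]] := @hahn_banach R _ _
  (mk_linear LL)
  (mk_linear fL) _ (rnorm_seminorm E).
  by move=> c; rewrite /= cabsM rnormZ (cabsR (rnorm_ge0 _)).
have [|G GE] := @bop_exists E R[i]^o g 1.
  by move=> y; rewrite mul1r; exact: gp.
exists G; split=> [y|]; first by rewrite GE.
by have := gf 1; rewrite /= scale1r mul1r GE.
Qed.

Lemma rnorm_le_dual E (x : E) (K : R) :
  (forall f : dual E, cabs (f x) <= K * rnorm f) -> 0 <= K -> rnorm x <= K.
Proof.
move=> xK K0; have [f [f1 fx]] := norming x.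
have := xK f; rewrite fx cabsR ?rnorm_ge0// => /le_trans; apply.
rewrite ler_piMr// bop_norm_le// => y; rewrite mul1r; exact: f1.
Qed.

Lemma dual_sep E (x y : E) : (forall f : dual E, f x = f y) -> x = y.
Proof.
move=> xy; have [f [_ fx]] := norming (x - y).
apply/subr0_eq/rnorm_eq0/realC_inj; rewrite -fx linearB/=.
by rewrite xy subrr.
Qed.

End BoundedOps.

(** * Completeness *)

(* Products of normed modules are pointed uniform spaces, as the statement that
   a Cauchy filter on them converges requires. *)
HB.saturate prod.

Section Completeness.
Variable R : realType.

Lemma complex_pos (e : R[i]) : 0 < e -> exists2 r : R, 0 < r & e = r%:C.
Proof.
move=> e0; exists (complex.Re e); last by rewrite RRe_real// gtr0_real.
by rewrite -ltcR RRe_real// gtr0_real.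
Qed.

Lemma norm_cauchyP (V : normedModType R[i]) (F : set_system V) :
  ProperFilter F ->
  cauchy F <->
  forall e : R, 0 < e -> exists x, F [set y | rnorm (x - y) < e].
Proof.
move=> FF; rewrite cauchyP; split=> [FC e e0|FC e /complex_pos[r r0 ->]].
  have e0' : 0 < e%:C by rewrite ltcR.
  have [x Fx] := FC _ e0'; exists x; apply: filterS Fx => y.
  by rewrite -ball_normE/= rnorm_lt.
have [x Fx] := FC r r0; exists x; apply: filterS Fx => y.
by rewrite -ball_normE/= rnorm_lt.
Qed.

Lemma norm_cvgP (V : normedModType R[i]) (T : Type) (F : set_system T)
    (u : T -> V) (l : V) : Filter F ->
  u @ F --> l <-> forall e : R, 0 < e -> F [set t | rnorm (l - u t) < e].
Proof.
move=> FF; split=> [/cvgrPdist_lt h e e0|h].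
  have e0' : 0 < e%:C by rewrite ltcR.
  by apply: filterS (h _ e0') => t /=; rewrite rnorm_lt.
apply/cvgrPdist_lt => _ /complex_pos[r r0 ->].
by apply: filterS (h _ r0) => t; rewrite /= rnorm_lt.
Qed.

Lemma rnorm_prod (U V : normedModType R[i]) (w : U * V) :
  rnorm w = Num.max (rnorm w.1) (rnorm w.2).
Proof.
apply: realC_inj; rewrite rnormE prodnormedzmodule.ProdNormedZmodule.prod_normE -!rnormE.
have [h|/ltW h] := leP (rnorm w.1) (rnorm w.2).
  by rewrite max_r ?lecR.
by rewrite max_l ?lecR.
Qed.

Lemma rnorm_fst (U V : normedModType R[i]) (w : U * V) : rnorm w.1 <= rnorm w.
Proof. by rewrite rnorm_prod le_max lexx. Qed.

Lemma rnorm_snd (U V : normedModType R[i]) (w : U * V) : rnorm w.2 <= rnorm w.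
Proof. by rewrite rnorm_prod le_max lexx orbT. Qed.

Lemma prod_complete (U V : normedModType R[i]) :
  (forall F : set_system U, ProperFilter F -> cauchy F -> cvg F) ->
  (forall F : set_system V, ProperFilter F -> cauchy F -> cvg F) ->
  forall F : set_system (U * V)%type, ProperFilter F -> cauchy F -> cvg F.
Proof.
move=> Uc Vc F FF /norm_cauchyP FC.
have /Uc/cvg_ex[l1 h1] : cauchy (fst @ F).
  apply/norm_cauchyP => e e0; have [x Fx] := FC _ e0; exists x.1.
  apply: (@filterS _ F _ _ _ _ Fx) => y /= h.
  by apply: le_lt_trans h; exact: (rnorm_fst (x - y)).
have /Vc/cvg_ex[l2 h2] : cauchy (snd @ F).
  apply/norm_cauchyP => e e0; have [x Fx] := FC _ e0; exists x.2.
  apply: (@filterS _ F _ _ _ _ Fx) => y /= h.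
  by apply: le_lt_trans h; exact: (rnorm_snd (x - y)).
apply/cvg_ex; exists (l1, l2); apply/norm_cvgP => e e0.
apply: filterS2 ((norm_cvgP _ _ _).1 h1 e e0) ((norm_cvgP _ _ _).1 h2 e e0) => w.
by rewrite /= rnorm_prod gt_max => -> ->.
Qed.


Lemma complex_complete (F : set_system R[i]^o) :
  ProperFilter F -> cauchy F -> cvg F.
Proof.
move=> FF /norm_cauchyP FC.
have cvgR (g : R[i] -> R) : (forall x y, g (x - y) = g x - g y) ->
    (forall x, `|g x| <= cabs x) ->
    exists l, forall e : R, 0 < e -> F [set t | `|l - g t| < e].
  move=> gB gle; have /R_complete/cvg_ex[l /cvgrPdist_lt gl] : cauchy (g @ F).
    apply: cauchy_exP => e e0; have [x Fx] := FC _ e0; exists (g x).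
    apply: (@filterS _ F _ _ _ _ Fx) => y /= h; rewrite -ball_normE/= -gB.
    exact: le_lt_trans (gle _) h.
  by exists l => e e0; exact: gl.
have [l1 h1] := cvgR (@complex.Re R) (raddfB _) (@normRe_le_cabs R).
have [l2 h2] := cvgR (@complex.Im R) (raddfB _) (@normIm_le_cabs R).
apply/cvg_ex; exists (l1 +i* l2); apply/norm_cvgP => e e0.
have e20 : 0 < e / 2 by rewrite divr_gt0.
apply: filterS2 (h1 _ e20) (h2 _ e20) => -[a b]/= ae be.
have abE : l1 +i* l2 - (a +i* b) = (l1 - a)%:C + 'i * (l2 - b)%:C.
  by rewrite [LHS]complexE.
have : cabs (l1 +i* l2 - (a +i* b)) < e; last by [].
rewrite abE (le_lt_trans (cabsD _ _))// [e]splitr ltrD//.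
  by rewrite cabs_real.
by rewrite cabsM cabs_real cabsi mul1r.
Qed.

(** The predual of the unitization of an algebra with predual [V].  The maximum norm is the one whose
    dual norm is the [l1] norm of the unitization. *)
Definition unit_predual (V : normedModType R[i]) : Type := (V * R[i]^o)%type.

HB.instance Definition _ (V : normedModType R[i]) :=
  NormedModule.copy (unit_predual V) (V * R[i]^o)%type.

HB.instance Definition _ (V : completeNormedModType R[i]) :=
  Uniform_isComplete.Build (unit_predual V)
    (prod_complete (@cauchy_cvg V) complex_complete).

Lemma norm_cauchy_seq (V : completeNormedModType R[i]) (u : nat -> V) :
  (forall e : R, 0 < e -> exists N, forall m n, (N <= m)%N -> (N <= n)%N ->
    rnorm (u m - u n) < e) ->
  exists l, forall e : R, 0 < e ->
    exists N, forall n, (N <= n)%N -> rnorm (l - u n) < e.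
Proof.
move=> uC; have /cauchy_cvg/cvg_ex[l /norm_cvgP ul] : cauchy (u @ \oo).
  apply/norm_cauchyP => e /uC[N uN]; exists (u N); exists N => //= n.
  exact: uN.
by exists l => e /ul[N _ uN]; exists N => n /uN.
Qed.

End Completeness.

(** * Finite sums of squares *)

Section FiniteEll2.
Variables (R : realType) (I : Type).
Implicit Types (s : seq I) (a b : I -> R).

Lemma cauchy_schwarz_sum s a b :
  (\sum_(i <- s) a i * b i) ^+ 2 <=
  (\sum_(i <- s) a i ^+ 2) * (\sum_(i <- s) b i ^+ 2).
Proof.
elim: s => [|i s]; first by rewrite !big_nil expr0n mul0r.
rewrite !big_cons; set c := \sum_(_ <- _) _; set p := \sum_(_ <- _) _.
set q := \sum_(_ <- _) _ => cpq; set x := a i; set y := b i.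
have p0 : 0 <= p by apply: sumr_ge0 => k _; exact: sqr_ge0.
have q0 : 0 <= q by apply: sumr_ge0 => k _; exact: sqr_ge0.
suff : 2 * c * (x * y) <= p * y ^+ 2 + q * x ^+ 2 by move=> h; nra.
have h0 : 0 <= p * y ^+ 2 + q * x ^+ 2.
  by rewrite addr_ge0// mulr_ge0// sqr_ge0.
have [h|h] := leP (2 * c * (x * y)) 0; first exact: le_trans h h0.
rewrite -ler_sqr ?nnegrE// ?(ltW h)//.
have xy0 := sqr_ge0 (x * y); have := sqr_ge0 (p * y ^+ 2 - q * x ^+ 2).
have := ler_wpM2r xy0 cpq; nra.
Qed.

Definition norm2 s a := Num.sqrt (\sum_(i <- s) a i ^+ 2).

Lemma norm2_ge0 s a : 0 <= norm2 s a.
Proof. exact: sqrtr_ge0. Qed.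

Lemma sqr_norm2 s a : norm2 s a ^+ 2 = \sum_(i <- s) a i ^+ 2.
Proof. by rewrite sqr_sqrtr// sumr_ge0// => i _; exact: sqr_ge0. Qed.

Lemma norm2_dot s a b : \sum_(i <- s) a i * b i <= norm2 s a * norm2 s b.
Proof.
rewrite (le_trans (ler_norm _))// -ler_sqr ?nnegrE ?mulr_ge0 ?norm2_ge0//.
by rewrite exprMn !sqr_norm2 real_normK ?num_real// cauchy_schwarz_sum.
Qed.

Lemma norm2_le s a (K : R) :
  0 <= K -> \sum_(i <- s) a i ^+ 2 <= K ^+ 2 -> norm2 s a <= K.
Proof. by move=> K0 aK; rewrite -ler_sqr ?nnegrE ?norm2_ge0// sqr_norm2. Qed.

Lemma ler_norm2 s a b : (forall i, 0 <= a i) -> (forall i, a i <= b i) ->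
  norm2 s a <= norm2 s b.
Proof.
move=> a0 ab; apply: norm2_le; rewrite ?norm2_ge0// sqr_norm2.
by apply: ler_sum => i _; rewrite ler_sqr ?nnegrE ?(le_trans (a0 i)).
Qed.

Lemma norm2D s a b : norm2 s (fun i => a i + b i) <= norm2 s a + norm2 s b.
Proof.
apply: norm2_le; first by rewrite addr_ge0 ?norm2_ge0.
have -> : \sum_(i <- s) (a i + b i) ^+ 2 =
    norm2 s a ^+ 2 + norm2 s b ^+ 2 + 2 * \sum_(i <- s) a i * b i.
  rewrite !sqr_norm2 mulr_sumr -!big_split/=; apply: eq_bigr => i _; ring.
have := norm2_dot s a b; rewrite sqrrD; lra.
Qed.

Lemma norm2Z s (t : R) a : 0 <= t -> norm2 s (fun i => t * a i) = t * norm2 s a.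
Proof.
move=> t0; rewrite /norm2; under eq_bigr do rewrite exprMn.
by rewrite -mulr_sumr sqrtrM ?sqr_ge0// sqrtr_sqr ger0_norm.
Qed.

Lemma norm2_sum s a : (forall i, 0 <= a i) -> norm2 s a <= \sum_(i <- s) a i.
Proof.
move=> a0; have s0 t : 0 <= \sum_(i <- t) a i by exact: sumr_ge0.
apply: norm2_le => //; elim: s => [|i s IH]; first by rewrite !big_nil expr0n.
by rewrite !big_cons; have := a0 i; have := s0 s; nra.
Qed.

End FiniteEll2.

(** * The weights *)

(** Interpolation between [X] and the range of the transpose of [T j], in dual
    form.  In the classical construction the weights on [X] are the gauges of
    [2^n W + 2^-n B], with [B] the unit ball and [W] a weakly compact set; here
    [|T j xi|] stands for the supremum of [|xi|] over [W], so that [dual_weight]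
    is the supremum over that sum of sets, and [weight] is the dual norm. *)
Section Interpolation.
Variables (R : realType) (X : completeNormedModType R[i]) (J : choiceType).
Variable T : J -> bop (dual X) X.
Local Notation I := (J * nat)%type.
Implicit Types (i : I) (s : seq I).

Definition dual_weight i (xi : dual X) : R :=
  2 ^+ i.2 * rnorm (T i.1 xi) + 2 ^- i.2 * rnorm xi.

Definition weight i (x : X) : R :=
  sup [set cabs (xi x) | xi in [set xi : dual X | dual_weight i xi <= 1]].

(* Discharges positivity side conditions through trivial closing steps. *)
Let pow2_gt0 n : 0 < 2 ^+ n :> R. Proof. by rewrite exprn_gt0. Qed.

Lemma dual_weight_seminorm i : seminorm (dual_weight i).
Proof.
have h2 : seminorm (fun xi : dual X => 2 ^- i.2 * rnorm xi).
  by apply: seminormZ; [rewrite invr_ge0 ltW|exact: rnorm_seminorm].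
apply: seminormD h2; apply: seminormZ; first exact: ltW.
by split=> [x y|a x]; rewrite ?linearD ?linearZ/= ?rnormD ?rnormZ.
Qed.

Lemma rnorm_le_dual_weight i xi : rnorm xi <= 2 ^+ i.2 * dual_weight i xi.
Proof.
rewrite /dual_weight mulrDr mulrA mulrA divff ?gt_eqF// mul1r.
by rewrite lerDr !mulr_ge0 ?rnorm_ge0// ltW.
Qed.

Lemma weight_has_sup i x :
  has_sup [set cabs (xi x) | xi in [set xi : dual X | dual_weight i xi <= 1]].
Proof.
split.
  exists (cabs ((0 : dual X) x)), 0 => //=.
  by rewrite /dual_weight linear0 !rnorm0 !mulr0 addr0.
exists (2 ^+ i.2 * rnorm x) => _ [xi /= xi1 <-].
rewrite (le_trans (bop_le xi x))// ler_wpM2r ?rnorm_ge0//.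
by rewrite (le_trans (rnorm_le_dual_weight i xi))// ler_piMr// ltW.
Qed.

Lemma dual_weight0 i : dual_weight i 0 = 0.
Proof. by rewrite /dual_weight linear0 !rnorm0 !mulr0 addr0. Qed.

Lemma weight_ub i x (xi : dual X) : dual_weight i xi <= 1 ->
  cabs (xi x) <= weight i x.
Proof.
by move=> h; apply: ub_le_sup; [have [] := weight_has_sup i x|exists xi].
Qed.

Lemma weight_ge0 i x : 0 <= weight i x.
Proof.
by rewrite (le_trans (cabs_ge0 ((0 : dual X) x)))// weight_ub// dual_weight0.
Qed.

Lemma weight_ge i x (xi : dual X) : cabs (xi x) <= dual_weight i xi * weight i x.
Proof.
have pS := dual_weight_seminorm i; have [_ pZ] := pS.
have [p0|p0] := eqVneq (dual_weight i xi) 0.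
  have /rnorm_eq0 -> : rnorm xi = 0.
    apply/eqP; rewrite eq_le rnorm_ge0 andbT.
    by rewrite (le_trans (rnorm_le_dual_weight i xi))// p0 mulr0.
  by rewrite dual_weight0 mul0r (_ : (0 : dual X) x = 0)// cabs0.
have pp : 0 < dual_weight i xi by rewrite lt_neqAle eq_sym p0 seminorm_ge0.
rewrite -ler_pdivrMl//.
have := weight_ub x (_ : dual_weight i ((dual_weight i xi)^-1%:C *: xi) <= 1).
rewrite cabsM cabsR ?invr_ge0 ?(ltW pp)//; apply.
rewrite (le_trans (pZ _ _))// cabsR ?invr_ge0 ?(ltW pp)//.
by rewrite mulVf.
Qed.

Lemma weight_le i x (K : R) :
  (forall xi, dual_weight i xi <= 1 -> cabs (xi x) <= K) -> weight i x <= K.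
Proof.
move=> h; apply: ge_sup; first by have [] := weight_has_sup i x.
by move=> _ [xi /= /h ? <-].
Qed.

Lemma weight_seminorm i : seminorm (weight i).
Proof.
split=> [x y|a x]; apply: weight_le => xi xi1; rewrite ?linearD ?linearZ/=.
  by rewrite (le_trans (cabsD _ _))// lerD// weight_ub.
by rewrite cabsM ler_wpM2l ?cabs_ge0// weight_ub.
Qed.

Lemma weight_le_rnorm i x : weight i x <= 2 ^+ i.2 * rnorm x.
Proof.
apply: weight_le => xi xi1; rewrite (le_trans (bop_le xi x))//.
rewrite ler_wpM2r ?rnorm_ge0//.
by rewrite (le_trans (rnorm_le_dual_weight i xi))// ler_piMr// ltW.
Qed.

Lemma rnorm_le_weight j x : rnorm x <= (rnorm (T j) + 1) * weight (j, 0%N) x.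
Proof.
have [f [f1 fx]] := norming x; rewrite -(cabsR (rnorm_ge0 x)) -fx.
rewrite (le_trans (weight_ge (j, 0%N) x f))// ler_wpM2r ?weight_ge0//.
rewrite /dual_weight/= expr0 mul1r invr1 mul1r.
have f1' : rnorm f <= 1 by apply: bop_norm_le => // y; rewrite mul1r; exact: f1.
by rewrite lerD// (le_trans (bop_le _ _))// ler_piMr// rnorm_ge0.
Qed.

End Interpolation.

(** * The interpolation space *)

Section InterpolationSpace.
Variables (R : realType) (X : completeNormedModType R[i]) (J : choiceType).
Variable T : J -> bop (dual X) X.
Local Notation I := (J * nat)%type.
Implicit Types (i : I) (s : seq I).

Definition partial_norm s (x : J -> X) : R := norm2 s (fun i => weight T i (x i.1)).

Lemma partial_norm_seminorm s : seminorm (partial_norm s : (J -> X) -> R).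
Proof.
split=> [x y|a x].
  apply: (le_trans _ (norm2D _ _ _)); apply: ler_norm2 => i.
    exact: weight_ge0.
  by have [wD _] := weight_seminorm T i; exact: wD.
rewrite -norm2Z ?cabs_ge0//; apply: ler_norm2 => i; first exact: weight_ge0.
by have [_ wZ] := weight_seminorm T i; exact: wZ.
Qed.

Definition square_summable : {pred J -> X} := fun x =>
  `[< exists K : R, forall s, uniq s -> partial_norm s x <= K >].

Lemma square_summable_submod_closed : submod_closed square_summable.
Proof.
split=> [|a x y /asboolP[K xK] /asboolP[M yM]]; apply/asboolP.
  exists 0 => s _; have [_ pZ] := partial_norm_seminorm s.
  by have := pZ 0 0; rewrite scale0r cabs0 mul0r.
exists (cabs a * K + M) => s us; have [pD pZ] := partial_norm_seminorm s.
rewrite (le_trans (pD _ _))// lerD ?yM// (le_trans (pZ _ _))//.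
by rewrite ler_wpM2l ?cabs_ge0// xK.
Qed.

HB.instance Definition _ := GRing.isSubmodClosed.Build R[i] (J -> X)
  square_summable square_summable_submod_closed.

(** The [l2] sum over [j : J] of the interpolation spaces attached to [T j], each
    of which is itself a diagonal in an [l2] sum over the level [n : nat].  The
    two summations are merged into one over [J * nat]. *)
Record interp := Interp {
  interp_fun :> J -> X; _ : interp_fun \in square_summable }.

HB.instance Definition _ := [isSub for interp_fun].
HB.instance Definition _ := [Choice of interp by <:].
HB.instance Definition _ := [SubChoice_isSubLmodule of interp by <:].

Lemma interpDE (x y : interp) j : (x + y) j = x j + y j. Proof. by []. Qed.
Lemma interpBE (x y : interp) j : (x - y) j = x j - y j. Proof. by []. Qed.
Lemma interpZE (a : R[i]) (x : interp) j : (a *: x) j = a *: x j.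
Proof. by []. Qed.

Definition interp_norm (x : interp) : R :=
  sup [set partial_norm s x | s in [set s | uniq s]].

Lemma interp_norm_has_sup (x : interp) :
  has_sup [set partial_norm s x | s in [set s | uniq s]].
Proof.
split; first by exists (partial_norm [::] x), [::].
by case: x => x /= /asboolP[K xK]; exists K => _ [s /= us <-]; exact: xK.
Qed.

Lemma partial_norm_le (x : interp) s : uniq s -> partial_norm s x <= interp_norm x.
Proof.
move=> us; apply: ub_le_sup; last by exists s.
by have [] := interp_norm_has_sup x.
Qed.

Lemma interp_norm_le (x : interp) (K : R) :
  (forall s, uniq s -> partial_norm s x <= K) -> interp_norm x <= K.
Proof.
move=> h; apply: ge_sup; first by have [] := interp_norm_has_sup x.
by move=> _ [s /= us <-]; exact: h.
Qed.

Lemma interp_norm_ge0 x : 0 <= interp_norm x.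
Proof. by rewrite (le_trans _ (@partial_norm_le x [::] _))// norm2_ge0. Qed.

Lemma weight_le_norm (x : interp) i : weight T i (x i.1) <= interp_norm x.
Proof.
rewrite (le_trans _ (@partial_norm_le x [:: i] _))// /partial_norm /norm2.
by rewrite big_seq1 sqrtr_sqr ger0_norm ?weight_ge0.
Qed.

Lemma interp_seminorm : seminorm (interp_norm : interp -> R).
Proof.
split=> [x y|a x]; apply: interp_norm_le => s us.
  have [pD _] := partial_norm_seminorm s; rewrite (le_trans (pD _ _))//.
  by rewrite lerD// partial_norm_le.
have [_ pZ] := partial_norm_seminorm s; rewrite (le_trans (pZ _ _))//.
by rewrite ler_wpM2l ?cabs_ge0// partial_norm_le.
Qed.

Lemma interp_normD (x y : interp) :
  (interp_norm (x + y))%:C <= (interp_norm x)%:C + (interp_norm y)%:C.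
Proof. by rewrite -rmorphD lecR; have [nD _] := interp_seminorm; exact: nD. Qed.

Lemma interp_normZ (a : R[i]) (x : interp) :
  (interp_norm (a *: x))%:C = `|a| * (interp_norm x)%:C.
Proof.
have [_ nZ] := interp_seminorm.
rewrite -cabsE -rmorphM; congr (_%:C); apply/eqP; rewrite eq_le nZ/=.
have [->|a0] := eqVneq a 0; first by rewrite cabs0 mul0r interp_norm_ge0.
have aa : 0 < cabs a by rewrite -ltcR cabsE normr_gt0.
rewrite -ler_pdivlMl//; have := nZ a^-1 (a *: x).
rewrite scalerA mulVf// scale1r; congr (_ <= _ * _).
by apply: realC_inj; rewrite fmorphV/= !cabsE normfV.
Qed.

Lemma interp_norm_eq0 (x : interp) : (interp_norm x)%:C = 0 -> x = 0.
Proof.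
move=> /realC_inj x0; apply/val_inj/funext => j; apply: rnorm_eq0.
apply/eqP; rewrite eq_le rnorm_ge0 andbT.
rewrite (le_trans (rnorm_le_weight T j _))//.
have -> : weight T (j, 0%N) (val x j) = 0; last by rewrite mulr0.
apply/eqP; rewrite eq_le weight_ge0 andbT -x0; exact: (weight_le_norm x (j, 0%N)).
Qed.

HB.instance Definition _ := Lmodule_isNormed.Build R[i] interp
  interp_normD interp_normZ interp_norm_eq0.

Lemma rnorm_interp (x : interp) : rnorm x = interp_norm x.
Proof. by []. Qed.

Lemma rnorm_coord (x : interp) j : rnorm (x j) <= (rnorm (T j) + 1) * rnorm x.
Proof.
rewrite (le_trans (rnorm_le_weight T j _))// ler_wpM2l//.
  by rewrite addr_ge0 ?rnorm_ge0.
exact: (weight_le_norm x (j, 0%N)).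
Qed.

Lemma partial_norm_le_sum s (x : J -> X) :
  partial_norm s x <= \sum_(i <- s) 2 ^+ i.2 * rnorm (x i.1).
Proof.
apply: (le_trans (norm2_sum _ _)) => [i|]; first exact: weight_ge0.
by apply: ler_sum => i _; exact: weight_le_rnorm.
Qed.

(** The coordinatewise limit of a Cauchy filter is a limit in norm because each
    finite partial norm is continuous for coordinatewise convergence. *)
Lemma interp_complete (F : set_system interp) :
  ProperFilter F -> cauchy F -> cvg F.
Proof.
move=> FF /norm_cauchyP FC.
have coordP j : exists l : X, forall e : R, 0 < e ->
    F [set y : interp | rnorm (l - y j) < e].
  have /cauchy_cvg/cvg_ex[l /norm_cvgP hl] : cauchy ((fun y : interp => y j) @ F).
    apply/norm_cauchyP => e e0; set c := rnorm (T j) + 1.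
    have c0 : 0 < c by rewrite ltr_wpDl ?rnorm_ge0.
    have [x Fx] := FC _ (divr_gt0 e0 c0); exists (x j).
    apply: (@filterS _ F _ _ _ _ Fx) => y /=; rewrite ltr_pdivlMr// mulrC.
    exact: le_lt_trans (rnorm_coord (x - y) j).
  by exists l => e /hl.
have [l lP] := choice coordP.
have sumP s (e : R) : 0 < e ->
    F [set y : interp | \sum_(i <- s) 2 ^+ i.2 * rnorm (l i.1 - y i.1) < e].
  elim: s e => [|i s IH] e e0.
    by apply: filterS filterT => y _ /=; rewrite big_nil.
  have e20 : 0 < e / 2 by rewrite divr_gt0.
  have p0 : 0 < 2 ^+ i.2 :> R by rewrite exprn_gt0.
  apply: filterS2 (IH _ e20) (lP i.1 _ (divr_gt0 e20 p0)) => y /= ys yi.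
  by rewrite big_cons [e]splitr addrC ltrD// mulrC -ltr_pdivlMr.
have tailP (e : R) : 0 < e -> exists2 A, F A & forall y, A y ->
    forall s, uniq s -> partial_norm s (fun j => l j - y j) <= e.
  move=> e0; have e30 : 0 < e / 3 by rewrite divr_gt0.
  have [x0 Fx] := FC _ e30; exists [set y | rnorm (x0 - y) < e / 3] => // y /= yA s us.
  have [z [/= zA zs]] := filter_ex (filterI Fx (sumP s _ e30)).
  have [pD _] := partial_norm_seminorm s.
  have -> : (fun j => l j - y j) =
      (fun j => l j - z j) + ((z - x0 : interp) + (x0 - y) : interp) :> (J -> X).
    by apply/funext => j; rewrite !fctE interpDE !interpBE !addrA !subrK.
  apply: (le_trans (pD _ _)).
  have h1 := le_trans (partial_norm_le_sum s (fun j => l j - z j)) (ltW zs).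
  have h2 := @partial_norm_le (z - x0 + (x0 - y)) s us.
  have h3 := rnormD (z - x0) (x0 - y).
  move: zA; rewrite -rnormN opprB => zA.
  move: h2 h3; rewrite -rnorm_interp; lra.
have lE : l \in square_summable.
  have [A FA /= AP] := tailP 1 ltr01; have [y Ay] := filter_ex FA.
  apply/asboolP; exists (1 + rnorm y) => s us.
  have [pD _] := partial_norm_seminorm s.
  have -> : l = (fun j => l j - y j) + (y : J -> X).
    by apply/funext => j; rewrite !fctE subrK.
  by rewrite (le_trans (pD _ _))// lerD ?AP// partial_norm_le.
apply/cvg_ex; exists (Interp lE); apply/norm_cvgP => e e0.
have e20 : 0 < e / 2 by rewrite divr_gt0.
have [A FA AP] := tailP _ e20; apply: filterS FA => y Ay /=.
apply: le_lt_trans (_ : e / 2 < e); last lra.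
by apply: interp_norm_le => s us; exact: AP.
Qed.

HB.instance Definition _ := Uniform_isComplete.Build interp interp_complete.

End InterpolationSpace.

(** * Closedness of a Banach space in its bidual *)

Section BidualClosed.
Variable R : realType.

Lemma le0_eps (a K : R) : 0 <= K -> (forall e, 0 < e -> a <= e * K) -> a <= 0.
Proof.
move=> K0 aK; apply/ler_addgt0Pl => e e0; rewrite addr0.
have h : 0 < e / (K + 1) by rewrite divr_gt0// ltr_wpDl.
rewrite (le_trans (aK _ h))// -mulrA ler_piMr ?(ltW e0)// mulrC.
by rewrite ler_pdivrMr ?ltr_wpDl// mul1r lerDl.
Qed.

Lemma cabs_eps (a b : R[i]) (K : R) : 0 <= K ->
  (forall e, 0 < e -> cabs (a - b) <= e * K) -> a = b.
Proof.
move=> K0 /(le0_eps K0) ab; apply/subr0_eq/cabs_eq0.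
by apply/eqP; rewrite eq_le ab cabs_ge0.
Qed.

(** The embedding of [X] in its bidual is isometric, so approximating points of
    [X] form a Cauchy sequence. *)
Lemma bidual_closed (X : completeNormedModType R[i]) (F : dual X -> R[i]) :
  (forall e : R, 0 < e -> exists v : X, forall xi : dual X,
    cabs (F xi - xi v) <= e * rnorm xi) ->
  exists v : X, forall xi : dual X, F xi = xi v.
Proof.
move=> Fv; have e0 (n : nat) : 0 < n.+1%:R^-1 :> R by rewrite invr_gt0 ltr0Sn.
have [v vP] := choice (fun n => Fv _ (e0 n)).
have [e ee|l lP] := @norm_cauchy_seq R X v.
  have [N Ne] : exists N : nat, N.+1%:R^-1 < e / 2.
    exists (Num.truncn (e / 2)^-1).
    rewrite invf_plt ?posrE ?divr_gt0 ?ltr0Sn//.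
    by rewrite truncnS_gt.
  exists N => m n Nm Nn; apply: (@le_lt_trans _ _ (m.+1%:R^-1 + n.+1%:R^-1)).
    apply: rnorm_le_dual => [xi|]; last by rewrite addr_ge0// ltW.
    rewrite linearB/= (_ : xi (v m) - xi (v n) =
      (F xi - xi (v n)) + - (F xi - xi (v m))); last ring.
    by rewrite (le_trans (cabsD _ _))// cabsN mulrDl addrC lerD.
  have le_inv k : (N <= k)%N -> k.+1%:R^-1 <= N.+1%:R^-1 :> R.
    by move=> Nk; rewrite lef_pV2 ?posrE ?ltr0Sn// ler_nat.
  apply: (le_lt_trans (lerD (le_inv _ Nm) (le_inv _ Nn))).
  by rewrite [e]splitr ltrD.
exists l => xi; apply: (@cabs_eps _ _ (2 * rnorm xi)).
  by rewrite mulr_ge0// rnorm_ge0.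
move=> e ee; have [N NP] := lP e ee.
have [M Me] : exists N : nat, N.+1%:R^-1 < e.
  exists (Num.truncn e^-1).
  by rewrite invf_plt ?posrE ?ltr0Sn// truncnS_gt.
pose n := maxn N M.
have Mn : n.+1%:R^-1 <= M.+1%:R^-1 :> R.
  by rewrite lef_pV2 ?posrE ?ltr0Sn// ler_nat ltnS leq_maxr.
rewrite (_ : F xi - xi l = (F xi - xi (v n)) - (xi l - xi (v n))); last ring.
rewrite (le_trans (cabsD _ _))// cabsN -linearB.
have h1 := vP n xi; have h2 := bop_le xi (l - v n).
have h3 := NP n (leq_maxl _ _); have x0 := rnorm_ge0 xi.
apply: le_trans (lerD h1 h2) _.
rewrite (_ : e * (2 * rnorm xi) = e * rnorm xi + rnorm xi * e); last ring.
by rewrite lerD// ?ler_wpM2r ?ler_wpM2l// ?(ltW h3)// (le_trans Mn)// ltW.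
Qed.

End BidualClosed.

(** * Coordinate functionals are dense in the dual *)

Section Density.
Variables (R : realType) (X : completeNormedModType R[i]) (J : choiceType).
Variable T : J -> bop (dual X) X.
Local Notation I := (J * nat)%type.
Local Notation E := (interp T).
Implicit Types (i : I) (s : seq I).

Lemma sum_mem_le (s r : seq I) (b : I -> R) : uniq s -> uniq r ->
  (forall i, 0 <= b i) -> \sum_(i <- r | i \in s) b i <= \sum_(i <- s) b i.
Proof.
move=> us ur b0; rewrite -big_filter.
rewrite (perm_big [seq i <- s | i \in r]); last first.
  by apply: uniq_perm; rewrite ?filter_uniq// => i; rewrite !mem_filter andbC.
by rewrite big_filter big_mkcond/=; apply: ler_sum => i _; case: ifP.
Qed.

Lemma tail_small (x : E) (d : R) : 0 < d -> rnorm x <= 1 ->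
  exists2 s, uniq s & forall r, uniq r -> (forall i, i \in r -> i \notin s) ->
    partial_norm T r x <= d.
Proof.
move=> d0 x1; have d20 : 0 < d ^+ 2 / 2 by rewrite divr_gt0// exprn_gt0.
have [_ [s us <-] sx] := sup_adherent d20 (interp_norm_has_sup x).
exists s => // r ur rs; apply: norm2_le; first exact: ltW.
have usr : uniq (s ++ r).
  by rewrite cat_uniq us ur andbT/=; apply/hasPn.
have := partial_norm_le x usr; rewrite -/(interp_norm x) in sx *.
have nx : interp_norm x <= 1 by [].
have := partial_norm_le x us.
have := norm2_ge0 s (fun i => weight T i (x i.1)); rewrite -/(partial_norm T s x).
have := norm2_ge0 (s ++ r) (fun i => weight T i (x i.1)); rewrite -/(partial_norm T _ x).
have := sqr_norm2 (s ++ r) (fun i => weight T i (x i.1)).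
have := sqr_norm2 s (fun i => weight T i (x i.1)).
rewrite -!/(partial_norm T _ x) big_cat/=.
move: (partial_norm T s x) (partial_norm T (s ++ r) x) sx => p q; nra.
Qed.

(** Moving a unit vector [x] in a direction [z] that is small where [x] is
    concentrated raises the norm only to second order: on [s] the products
    [x_i z_i] are small because [z] is, off [s] because [x] is. *)
Lemma norm_perturb (x z : E) s (d t eta : R) : 0 <= t -> 0 <= eta -> 0 <= d ->
  rnorm x <= 1 -> rnorm z <= 1 -> uniq s ->
  (forall r, uniq r -> (forall i, i \in r -> i \notin s) ->
    partial_norm T r x <= d) ->
  \sum_(i <- s) weight T i (z i.1) <= eta ->
  rnorm (x + t%:C *: z) <= 1 + t * (eta + d) + t ^+ 2 / 2.
Proof.
move=> t0 eta0 d0 x1 z1 us sx sz; apply: interp_norm_le => r ur.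
set a := fun i : I => weight T i (x i.1); set b := fun i : I => weight T i (z i.1).
have a0 i : 0 <= a i by exact: weight_ge0.
have b0 i : 0 <= b i by exact: weight_ge0.
have -> : 1 + t * (eta + d) + t ^+ 2 / 2 = 1 + (t * (eta + d) + t ^+ 2 / 2) by ring.
set u := t * _ + _; have u0 : 0 <= u.
  by rewrite addr_ge0 ?mulr_ge0 ?addr_ge0 ?sqr_ge0// invr_ge0.
apply: (@le_trans _ _ (norm2 r (fun i => a i + t * b i))).
  apply: ler_norm2 => i; first exact: weight_ge0.
  have [wD wZ] := weight_seminorm T i.
  rewrite interpDE (le_trans (wD _ _))// lerD// interpZE.
  by rewrite (le_trans (wZ _ _))// cabsR.
apply: norm2_le; first by rewrite addr_ge0.
have -> : \sum_(i <- r) (a i + t * b i) ^+ 2 = norm2 r a ^+ 2 +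
    2 * t * (\sum_(i <- r) a i * b i) + t ^+ 2 * norm2 r b ^+ 2.
  by rewrite !sqr_norm2 !mulr_sumr -!big_split/=; apply: eq_bigr => i _; ring.
have ra : norm2 r a <= 1 by exact: le_trans (partial_norm_le x ur) x1.
have rb : norm2 r b <= 1 by exact: le_trans (partial_norm_le z ur) z1.
have ra2 : norm2 r a ^+ 2 <= 1 by have := norm2_ge0 r a; nra.
have rb2 : norm2 r b ^+ 2 <= 1 by have := norm2_ge0 r b; nra.
have rab : \sum_(i <- r) a i * b i <= eta + d.
  rewrite (bigID (mem s))/= lerD//.
    apply: le_trans sz; apply: (le_trans _ (sum_mem_le us ur b0)).
    apply: ler_sum => i _; rewrite ler_piMl//.
    exact: le_trans (weight_le_norm x i) x1.
  rewrite -big_filter; set r' := [seq _ <- _ | _].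
  have ur' : uniq r' by rewrite filter_uniq.
  rewrite (le_trans (norm2_dot _ _ _))//.
  have := sx r' ur'; rewrite /partial_norm -/a => /(_ _).
  have r's i : i \in r' -> i \notin s by rewrite mem_filter => /andP[].
  move=> /(_ r's) r'a.
  have r'b : norm2 r' b <= 1 by exact: le_trans (partial_norm_le z ur') z1.
  by rewrite (le_trans (ler_pM (norm2_ge0 _ _) (norm2_ge0 _ _) r'a r'b))// mulr1.
have t20 := sqr_ge0 t.
rewrite /u in u0 *; move: ra2 rb2 rab (norm2_ge0 r b) u0.
move: (norm2 r a) (norm2 r b) (\sum_(i <- r) _) => p q w.
move=> ra2 rb2 rab q0 u0.
have h1 := ler_wpM2l t0 rab; have h2 := ler_wpM2l t20 rb2.
have h3 := sqr_ge0 (t * (eta + d) + t ^+ 2 / 2).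
move: h3 h1 h2; set v := _ + _ / 2; rewrite sqrrD /v; nra.
Qed.

End Density.

Section Reflexivity.
Variables (R : realType) (X : completeNormedModType R[i]) (J : choiceType).
Variable T : J -> bop (dual X) X.
Local Notation I := (J * nat)%type.
Local Notation E := (interp T).
Implicit Types (i : I) (s : seq I).

Lemma coord_bounded j (xi : dual X) :
  (fun x : E => xi (x j) : R[i]^o) \in @bounded_linear R E R[i]^o.
Proof.
apply/asboolP; split=> [a x y|]; first exact: linearP.
exists (rnorm xi * (rnorm (T j) + 1)) => x.
rewrite -rnormE -[X in _ * X]rnormE -rmorphM/= lecR.
by rewrite (le_trans (bop_le _ _))// -mulrA ler_wpM2l ?rnorm_ge0 ?rnorm_coord.
Qed.

Definition coord_dual j (xi : dual X) : dual E := Bop (coord_bounded j xi).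

Lemma coordE j xi (x : E) : coord_dual j xi x = xi (x j). Proof. by []. Qed.

Lemma coord_le i xi (x : E) :
  cabs (coord_dual i.1 xi x) <= dual_weight T i xi * weight T i (x i.1).
Proof. by rewrite coordE weight_ge. Qed.

Lemma coord_norm_le i xi : rnorm (coord_dual i.1 xi) <= dual_weight T i xi.
Proof.
have p0 : 0 <= dual_weight T i xi by exact: seminorm_ge0 (dual_weight_seminorm T i).
apply: bop_norm_le => // x; rewrite (le_trans (coord_le _ _ _))//.
by rewrite ler_wpM2l// weight_le_norm.
Qed.

Lemma weight_phase i (c : R[i]) (x : X) : cabs c = 1 -> weight T i (c *: x) <= weight T i x.
Proof. by move=> c1; have [_ /(_ c x)] := weight_seminorm T i; rewrite c1 mul1r. Qed.

(** A functional almost attaining its norm at [x] is almost determined by the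
    indices where [x] is concentrated: if [z] is small there, then moving from
    [x] to [x + t z] raises the norm by [O(t^2)] only ([norm_perturb]), whereas
    the functional gains [t |f z|].  This is where the [l2] summation is used;
    an [l1] sum would not do. *)
Lemma local_domination (f : dual E) (e : R) : 0 < e ->
  exists s, exists2 K : R, 0 <= K &
    forall z : E, cabs (f z) <= \sum_(i <- s) K * weight T i (z i.1) + e * rnorm z.
Proof.
move=> e0; set S := rnorm f; have S0 : 0 <= S by exact: rnorm_ge0.
(* The perturbation argument yields a bound (5/2 S + 1) t with t <= 1; this t
   makes it at most e. *)
pose t := e / (3 * S + 1 + e).
have den0 : 0 < 3 * S + 1 + e by rewrite ltr_wpDl// addr_ge0// mulr_ge0.
have t0 : 0 < t by rewrite divr_gt0.
have te : t * (3 * S + 1 + e) = e by rewrite /t divfK// gt_eqF.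
have t20 : 0 < t ^+ 2 by rewrite exprn_gt0.
have [_ [x0 /= x01 <-] fx0] := sup_adherent t20 (opnorm_has_sup f).
rewrite -/(opnorm f) -(rnorm_bop f) -/S in fx0.
rewrite -(rnorm_le _ 1) in x01.
have [x x1 fx] : exists2 x : E, rnorm x <= 1 & f x = (cabs (f x0))%:C.
  have [c c1 cf] := phaseP (f x0); exists (c *: x0).
    by rewrite rnormZ c1 mul1r.
  by rewrite linearZ.
have [s us sx] := tail_small t20 x1.
exists s, (e / t); first by rewrite divr_ge0// ltW.
have unit_bound (z : E) : rnorm z <= 1 -> \sum_(i <- s) weight T i (z i.1) <= t ->
    cabs (f z) <= e.
  move=> z1 sz; have [b b1 bf] := phaseP (f z).
  have bz1 : rnorm (b *: z) <= 1 by rewrite rnormZ b1 mul1r.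
  have sbz : \sum_(i <- s) weight T i ((b *: z) i.1) <= t.
    apply: le_trans sz; apply: ler_sum => i _; exact: weight_phase.
  have h1 := norm_perturb (ltW t0) (ltW t0) (ltW t20) x1 bz1 us sx sbz.
  have h2 := bop_le f (x + t%:C *: (b *: z)).
  have h3 : cabs (f x0) + t * cabs (f z) <= rnorm (f (x + t%:C *: (b *: z))).
    apply: (le_trans _ (Re_le_cabs _)).
    rewrite linearD linearZ/= fx linearZ/= /GRing.scale/= bf.
    by rewrite -!rmorphM -rmorphD.
  have h4 := le_trans h2 (ler_wpM2l S0 h1).
  have {}h4 := le_trans h3 h4.
  have fz0 := cabs_ge0 (f z).
  rewrite -(ler_pM2l t0).
  have fx0' : S - t ^+ 2 < cabs (f x0) by exact: fx0.
  have t1 : t <= 1 by rewrite ler_pdivrMr// mul1r lerDr addr_ge0// mulr_ge0.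
  have h5 : t * t ^+ 2 <= t * t by rewrite ler_pM2l// expr2 ler_piMl// ltW.
  have h6 := ler_wpM2l S0 h5.
  move: te h4 h6; move: (cabs (f z)) (cabs (f x0)) fx0' => u v; clear -t0 S0 e0 t20.
  move=> vS te h4 h6; have h7 : t * (t * (3 * S + 1 + e)) = t * e by rewrite te.
  have h8 := mulr_ge0 S0 (ltW t20); have h9 := mulr_ge0 (ltW e0) (ltW t20).
  nra.
move=> z; pose M := \sum_(i <- s) weight T i (z i.1).
have M0 : 0 <= M by apply: sumr_ge0 => i _; exact: weight_ge0.
rewrite -mulr_sumr -/M.
pose r := rnorm z + M / t.
have [z0|z0] := eqVneq (rnorm z) 0.
  rewrite (rnorm_eq0 z0) linear0 (_ : cabs _ = 0) ?cabs0// rnorm0 mulr0 addr0.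
  by rewrite mulr_ge0// divr_ge0// ltW.
have r0 : 0 < r.
  apply: ltr_pwDl; last by rewrite divr_ge0// ltW.
  by rewrite lt_neqAle eq_sym z0 rnorm_ge0.
have ri0 : 0 <= r^-1 by rewrite invr_ge0 ltW.
have zr1 : rnorm (r^-1%:C *: z) <= 1.
  by rewrite rnormZ cabsR// ler_pdivrMl// mulr1 lerDl divr_ge0// ltW.
have zrs : \sum_(i <- s) weight T i ((r^-1%:C *: z) i.1) <= t.
  apply: (@le_trans _ _ (r^-1 * M)).
    rewrite mulr_sumr; apply: ler_sum => i _; rewrite interpZE.
    have [_ wZ] := weight_seminorm T i.
    by rewrite (le_trans (wZ _ _))// cabsR.
  by rewrite ler_pdivrMl// mulrDl divfK ?gt_eqF// lerDr mulr_ge0 ?rnorm_ge0// ltW.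
have := unit_bound _ zr1 zrs; rewrite linearZ/= cabsM cabsR// ler_pdivrMl// => h.
apply: (le_trans h).
rewrite le_eqVlt; apply/orP; left; apply/eqP; rewrite /r; field.
by rewrite gt_eqF.
Qed.

(** [local_domination] bounds [f] by finitely many coordinate weights up to
    [e * rnorm]; a functional dominated by the weight of one coordinate factors
    through that coordinate. *)
Lemma coord_dense (f : dual E) (e : R) : 0 < e ->
  exists r : seq (J * dual X), forall x : E,
    cabs (f x - \sum_(p <- r) p.2 (x p.1)) <= e * rnorm x.
Proof.
move=> e0; have [s [K K0 fs]] := local_domination f e0.
pose S (g : E -> R[i]) := exists r : seq (J * dual X), forall x : E,
  g x = \sum_(p <- r) p.2 (x p.1).
have coordL j : linear (fun x : E => x j) by [].
have [||||||g [h [[r gE] hq fE]]] := @hahn_banach_span R E S I s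
    (fun i x => K * weight T i (x i.1)) (fun x => e * rnorm x) f.
- by exists [::] => x; rewrite big_nil.
- move=> g h [r gE] [r' hE]; exists (r ++ r') => x.
  by rewrite big_cat gE hE.
- move=> i g gK.
  have [|k [kK kg]] := @hahn_banach R E X (mk_linear (coordL i.1)) g
      (fun v => K * weight T i v) (seminormZ K0 (weight_seminorm T i)).
    by [].
  have [|xi xiE] := @bop_exists R X R[i]^o k (K * 2 ^+ i.2).
    move=> v; apply: (le_trans (kK v)); rewrite -mulrA ler_wpM2l//.
    exact: weight_le_rnorm.
  by exists [:: (i.1, xi)] => x; rewrite big_seq1/= xiE -kg.
- move=> i; apply: seminormZ => //.
  have [wD wZ] := weight_seminorm T i.
  by split=> [x y|a x]; rewrite ?interpDE ?interpZE.
- by apply: seminormZ; [exact: ltW|exact: rnorm_seminorm].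
- exact: fs.
exists r => x; rewrite -gE fE addrAC subrr add0r; exact: hq.
Qed.

Lemma weight_attain i (x : X) (th : R) : 0 < th < 1 ->
  exists2 xi : dual X, dual_weight T i xi <= 1 &
    th * weight T i x <= complex.Re (xi x).
Proof.
move=> /andP[th0 th1]; have [w0|w0] := eqVneq (weight T i x) 0.
  by exists 0; rewrite ?dual_weight0// w0 mulr0.
have wp : 0 < weight T i x by rewrite lt_neqAle eq_sym w0 weight_ge0.
have [|_ [xi /= xi1 <-] h] := @sup_adherent _ _ ((1 - th) * weight T i x) _ (weight_has_sup T i x).
  by rewrite mulr_gt0// subr_gt0.
have [c c1 cx] := phaseP (xi x); exists (c *: xi).
  by have [_ /(_ c xi)] := dual_weight_seminorm T i; rewrite c1 mul1r => /le_trans; apply.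
rewrite bopZE /GRing.scale/= cx/=.
move: h; rewrite -/(weight T i x); lra.
Qed.

(** * Reflexivity *)

Section BidualElement.
Variable Phi : dual (dual E).
Variable x : J -> X.
Hypothesis Phix : forall j xi, Phi (coord_dual j xi) = xi (x j).

(** Testing [Phi] on the combination of coordinate functionals that nearly attain
    the weights of [x], with the weights as coefficients, gives
    [N ^ 2 <= |Phi| N] for every partial norm [N] of [x]. *)
Lemma bidual_partial_norm s : uniq s -> partial_norm T s x <= rnorm Phi.
Proof.
move=> us; set N := partial_norm T s x; have N0 : 0 <= N by exact: norm2_ge0.
have key th : 0 < th < 1 -> th * N <= rnorm Phi.
  move=> th01; have [xi xi1 xiw] : exists2 xi : I -> dual X,
      forall i, dual_weight T i (xi i) <= 1 &
      forall i, th * weight T i (x i.1) <= complex.Re (xi i (x i.1)).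
    have /choice[xi xiP] : forall i, exists xi : dual X, dual_weight T i xi <= 1 /\
        th * weight T i (x i.1) <= complex.Re (xi (x i.1)).
      by move=> i; have [xi] := weight_attain i (x i.1) th01; exists xi.
    by exists xi => i; case: (xiP i).
  pose g : dual E := \sum_(i <- s) (weight T i (x i.1))%:C *: coord_dual i.1 (xi i).
  have gE (z : E) : g z = \sum_(i <- s) (weight T i (x i.1))%:C * xi i (z i.1).
    exact: bop_sumE.
  have gN : rnorm g <= N.
    apply: bop_norm_le => // z; rewrite gE.
    apply: (@le_trans _ _ (\sum_(i <- s) weight T i (x i.1) * weight T i (z i.1))).
      rewrite (le_trans (cabs_sum _ _))//; apply: ler_sum => i _.
      by rewrite cabsM cabsR ?weight_ge0// ler_wpM2l ?weight_ge0// weight_ub.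
    by rewrite (le_trans (norm2_dot _ _ _))// ler_wpM2l// partial_norm_le.
  have Pg : th * N ^+ 2 <= cabs (Phi g).
    rewrite (le_trans _ (Re_le_cabs _))// linear_sum/= raddf_sum/= /N sqr_norm2 mulr_sumr.
    apply: ler_sum => i _; rewrite linearZ/= Phix.
    have := xiw i; have := weight_ge0 T i (x i.1).
    case: (xi i (x i.1)) => a b /= w0 h.
    by rewrite mul0r subr0 expr2 mulrCA ler_wpM2l.
  have := le_trans Pg (le_trans (bop_le Phi g) (ler_wpM2l (rnorm_ge0 _) gN)).
  have [->|Nn0] := eqVneq N 0; first by move=> _; rewrite mulr0 rnorm_ge0.
  by rewrite expr2 mulrA ler_pM2r// lt_neqAle eq_sym Nn0.
rewrite leNgt; apply/negP => PN; have P0 := rnorm_ge0 Phi.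
have N0' : 0 < N by exact: le_lt_trans P0 PN.
have := key ((rnorm Phi + N) / (2 * N)) _.
rewrite divr_gt0 ?mulr_gt0 ?ltr_wpDl//= ltr_pdivrMr ?mulr_gt0// mul1r.
move=> /(_ _); rewrite (_ : _ / _ * N = (rnorm Phi + N) / 2); last by field; rewrite gt_eqF.
move=> h; have : (rnorm Phi + N) / 2 <= rnorm Phi by apply: h; lra.
lra.
Qed.

End BidualElement.

(* The transpose of T j maps X' into X and not merely into the bidual of X; weak
   compactness of the orbits enters in this form. *)
Hypothesis wc : forall j (G : dual X), exists y : X, forall xi, G (T j xi) = xi y.

(** For every level [n] the functional [xi |-> Phi (coord_dual j xi)] is dominated
    by [|Phi| (2^n |T j xi| + 2^-n |xi|)].  It splits accordingly; the first part
    factors through [T j] and is evaluation at a point by [wc], the second has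
    norm at most [|Phi| 2^-n]. *)
Lemma bidual_coord (Phi : dual (dual E)) j :
  exists v : X, forall xi : dual X, Phi (coord_dual j xi) = xi v.
Proof.
apply: bidual_closed => e e0; set C := rnorm Phi; have C0 : 0 <= C by exact: rnorm_ge0.
have [n ne] : exists n : nat, C * 2 ^- n <= e.
  exists (Num.truncn (C / e)); rewrite ler_pdivrMr ?exprn_gt0// mulrC -ler_pdivrMr//.
  rewrite (le_trans (ltW (truncnS_gt _)))// -natrX ler_nat.
  exact: ltn_expl.
have FL : linear (fun xi => Phi (coord_dual j xi)).
  move=> a xi eta; rewrite -linearP; congr (Phi _); exact/val_inj.
have [|||g [h [gp hq FE]]] := @hahn_banach_sum R (dual X) (mk_linear FL)
    (fun xi => C * 2 ^+ n * rnorm (T j xi)) (fun xi => C * 2 ^- n * rnorm xi).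
- apply: seminormZ; first by rewrite mulr_ge0// exprn_ge0.
  by split=> [x y|a x]; rewrite ?linearD ?linearZ/= ?rnormD ?rnormZ.
- apply: seminormZ; last exact: rnorm_seminorm.
  by rewrite mulr_ge0// invr_ge0 exprn_ge0.
- move=> xi /=; rewrite (le_trans (bop_le Phi _))// -!mulrA -mulrDr.
  by rewrite ler_wpM2l// (coord_norm_le (j, n)).
have [||G [Gp GE]] := @hahn_banach R (dual X) X (T j) g (fun v => C * 2 ^+ n * rnorm v).
- apply: seminormZ; last exact: rnorm_seminorm.
  by rewrite mulr_ge0// exprn_ge0.
- exact: gp.
have [|G' G'E] := @bop_exists R X R[i]^o G (C * 2 ^+ n); first exact: Gp.
have [v vE] := wc j G'; exists v => xi.
have -> : Phi (coord_dual j xi) = g xi + h xi by exact: FE.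
rewrite -GE -G'E vE addrAC subrr add0r (le_trans (hq _))//.
by rewrite ler_wpM2r ?rnorm_ge0.
Qed.

Theorem interp_reflexive : reflexive_space E.
Proof.
move=> Phi; have [x xP] := choice (bidual_coord Phi).
have xE : x \in square_summable T.
  by apply/asboolP; exists (rnorm Phi) => s us; exact: bidual_partial_norm.
exists (Interp xE) => f; set z := Interp xE.
apply: (@cabs_eps _ _ _ (rnorm Phi + rnorm z)); first by rewrite addr_ge0 ?rnorm_ge0.
move=> e e0; have [r rP] := coord_dense f e0.
pose g : dual E := \sum_(p <- r) coord_dual p.1 p.2.
have gE (y : E) : g y = \sum_(p <- r) p.2 (y p.1).
  exact: bop_sumE.
have fg : rnorm (f - g) <= e.
  by apply: bop_norm_le => [|y]; [exact: ltW|have := rP y; rewrite -gE].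
have Pg : Phi g = g z.
  rewrite gE linear_sum/=; apply: eq_bigr => p _; exact: xP.
have -> : Phi f - f z = Phi (f - g) - (f z - g z).
  by rewrite linearB/= Pg; ring.
rewrite (le_trans (cabsD _ _))// cabsN mulrDr lerD//.
  by rewrite (le_trans (bop_le _ _))// mulrC ler_wpM2r ?rnorm_ge0.
by rewrite gE rP.
Qed.

End Reflexivity.

(** * Functionals continuous for an initial topology *)

Section InitialTopology.

Lemma initial_cvgP (S : choiceType) (T : topologicalType) (f : S -> T)
    (F : set_system S) (s : S) : Filter F ->
  F --> (s : initial_topology f) <-> f @ F --> f s.
Proof.
move=> FF; split=> [Fs|fFs].
  by move=> A fA; apply: Fs; exact: (@initial_continuous S T f s A fA).
move=> A /= [_ [[B Bop <-] Bfs BA]].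
by apply: filterS BA _; apply: fFs; exact: open_nbhs_nbhs.
Qed.

Lemma sigma_cvgP (R : realType) (X : choiceType) (I : Type) (ev : X -> I -> R[i])
    (F : set_system X) (x : X) : Filter F ->
  F --> (x : sigma_topology ev) <->
  forall i, (fun y => ev y i : R[i]^o) @ F --> (ev x i : R[i]^o).
Proof.
move=> FF.
have -> : (F --> (x : sigma_topology ev)) =
    (ev @ F --> (ev x : {ptws I -> R[i]^o})).
  apply/propext; exact: (@initial_cvgP X {ptws I -> R[i]^o} ev F x FF).
split=> [/cvg_sup h i|h].
  exact/(@initial_cvgP (I -> R[i]^o) R[i]^o (fun f => f i) (ev @ F) (ev x) _).1/(h i).
apply/cvg_sup => i.
exact/(@initial_cvgP (I -> R[i]^o) R[i]^o (fun f => f i) (ev @ F) (ev x) _).2/(h i).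
Qed.

(** Continuity is only tested at [0] and along filters, which is enough for the
    filter generated by the finite intersections of the strips
    [|ev x i| < e]; it gives a bound of [f] by finitely many [|ev x i|], and
    [hahn_banach_span] with [q = 0] makes [f] a combination of them. *)
Lemma sigma_functional (R : realType) (X : lmodType R[i]) (I : Type)
    (ev : X -> I -> R[i]) (f : {linear X -> R[i]^o}) :
  (forall i, linear (fun x => ev x i : R[i]^o)) ->
  (forall F : set_system X, Filter F -> F --> (0 : sigma_topology ev) ->
    f @ F --> f 0) ->
  exists r : seq (R[i] * I), forall x, f x = \sum_(p <- r) p.1 * ev x p.2.
Proof.
move=> evL fc.
pose M s x : R := \sum_(i <- s) cabs (ev x i).
have MS s : seminorm (M s).
  apply: seminorm_sum => i; split=> [x y|a x].
    have := evL i 1 x y; rewrite !scale1r => ->; exact: cabsD.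
  by have -> : ev (a *: x) i = a * ev x i := scalable_linear (evL i) a x; rewrite cabsM.
pose F : set_system X :=
  [set U | exists s, exists2 e : R, 0 < e & forall x, M s x < e -> U x].
have FF : Filter F.
  split=> [|U V [s [e e0 sU]] [t [d d0 tV]]|U V UV [s [e e0 sU]]].
  - by exists [::], 1.
  - exists (s ++ t), (Num.min e d); first by rewrite lt_min e0.
    move=> x; rewrite /M big_cat/= lt_min => /andP[h1 h2]; split.
      by apply: sU; rewrite (le_lt_trans _ h1)// lerDl; exact: seminorm_ge0 (MS t).
    by apply: tV; rewrite (le_lt_trans _ h2)// lerDr; exact: seminorm_ge0 (MS s).
  - by exists s, e => // x /sU; exact: UV.
have ev0 i : ev 0 i = 0 := linear0 (mk_linear (evL i)).
have F0 : F --> (0 : sigma_topology ev).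
  apply/sigma_cvgP => i; apply/norm_cvgP => e e0; exists [:: i], e => // x.
  by rewrite /M big_seq1 /= ev0 sub0r rnormN.
have /norm_cvgP/(_ 1 ltr01)[s [e e0 /= sf]] := fc F FF F0.
have fM x : cabs (f x) <= \sum_(i <- s) (2 / e) * cabs (ev x i).
  rewrite -mulr_sumr -/(M s x); have M0 : 0 <= M s x := seminorm_ge0 x (MS s).
  have K0 : 0 < 2 / e by rewrite divr_gt0.
  apply/ler_addgt0Pl => d d0; set m := M s x + d / (2 / e).
  have m0 : 0 < m by rewrite ltr_wpDl ?divr_gt0.
  have t0 : 0 <= e / 2 / m by rewrite !divr_ge0 ?ltW.
  have [_ MZ] := MS s.
  have := sf ((e / 2 / m)%:C *: x) _; rewrite linear0 sub0r rnormN linearZ.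
  rewrite rnormZ cabsR// => h; have {h} : e / 2 / m * cabs (f x) < 1.
    apply: h; apply: (le_lt_trans (MZ _ _)); rewrite cabsR//.
    rewrite mulrAC ltr_pdivrMr// /m; have : 0 < e * (d / (2 / e)) by rewrite mulr_gt0 ?divr_gt0.
    by have := mulr_ge0 (ltW e0) M0; lra.
  rewrite mulrC -ltr_pdivlMr ?divr_gt0 ?divr_gt0// => /ltW/le_trans; apply.
  rewrite le_eqVlt; apply/orP; left; apply/eqP; rewrite /m; field.
  by rewrite !gt_eqF//= ltr_wpDl ?mulr_ge0 ?mulr_gt0.
pose S (g : X -> R[i]) := exists r : seq (R[i] * I), forall x,
  g x = \sum_(p <- r) p.1 * ev x p.2.
have [||||||g [h [[r gE] h0 fE]]] := @hahn_banach_span R X S I s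
    (fun i x => (2 / e) * cabs (ev x i)) (fun=> 0) f.
- by exists [::] => x; rewrite big_nil.
- by move=> g h [r gE] [r' hE]; exists (r ++ r') => x; rewrite big_cat gE hE.
- move=> i g gK.
  have [|k [kK kg]] := @hahn_banach R X R[i]^o (mk_linear (evL i)) g
      (fun v => (2 / e) * rnorm v) _ gK.
    by apply: seminormZ; [rewrite divr_ge0// ltW|exact: rnorm_seminorm].
  exists [:: (k 1, i)] => x; rewrite big_seq1/= -kg/=.
  by rewrite -[in LHS](mulr1 (ev x i)) -/(ev x i *: (1 : R[i]^o)) linearZ mulrC.
- move=> i; apply: seminormZ; first by rewrite divr_ge0// ltW.
  split=> [x y|a x].
    have := evL i 1 x y; rewrite !scale1r => ->; exact: cabsD.
  by have -> : ev (a *: x) i = a * ev x i := scalable_linear (evL i) a x; rewrite cabsM.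
- by split=> *; rewrite ?addr0 ?mulr0.
- by move=> x; rewrite addr0.
exists r => x; rewrite -gE fE (_ : h x = 0) ?addr0//.
by apply/cabs_eq0/eqP; rewrite eq_le h0 cabs_ge0.
Qed.

End InitialTopology.

(** * The action on the predual of the unitization *)

Section DualBanachAlgebra.
Variables (R : realType) (A Astar : completeNormedModType R[i]).
Variables (mul : A -> A -> A) (pair : A -> dual Astar).
Hypothesis H : dual_banach_algebra mul pair.

Local Notation X := (unit_predual Astar).

Lemma pairD a b phi : pair (a + b) phi = pair a phi + pair b phi.
Proof. by have := dba_linear H 1 a b; rewrite !scale1r => ->. Qed.

Lemma pairZ c a phi : pair (c *: a) phi = c * pair a phi.
Proof. by rewrite (scalable_linear (dba_linear H)). Qed.

Lemma pair_linear phi : linear (fun a => pair a phi : R[i]^o).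
Proof. by move=> c a b; rewrite pairD pairZ. Qed.

Lemma rnorm_pair a : rnorm (pair a) = rnorm a.
Proof. by apply: realC_inj; rewrite !rnormE (dba_isometric H). Qed.

Lemma pair_le a phi : cabs (pair a phi) <= rnorm a * rnorm phi.
Proof. by rewrite -rnorm_pair; exact: bop_le. Qed.

Lemma pair_norming phi (K : R) : 0 <= K ->
  (forall a, cabs (pair a phi) <= K * rnorm a) -> rnorm phi <= K.
Proof.
move=> K0 h; apply: rnorm_le_dual => // f.
by have [a <-] := dba_surjective H f; rewrite rnorm_pair.
Qed.

Lemma pair_sep phi psi : (forall a, pair a phi = pair a psi) -> phi = psi.
Proof.
by move=> h; apply: dual_sep => f; have [a <-] := dba_surjective H f.
Qed.

(** A weak-star continuous functional is evaluation at a point of the predual, so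
    that weak-star continuous operators on [A] have a transpose on [Astar]. *)
Lemma weak_star_functional (f : A -> A) phi : linear f ->
  continuous (f : weak_star pair -> weak_star pair) ->
  exists psi, forall b, pair b psi = pair (f b) phi.
Proof.
move=> fL fc; have gL : linear (fun b => pair (f b) phi : R[i]^o).
  by move=> c a b; rewrite fL pairD pairZ.
have [|F FF F0|r rE] := @sigma_functional R A Astar (fun a phi => pair a phi) (mk_linear gL).
- by move=> i; exact: pair_linear.
- have f0 : f 0 = 0 := linear0 (mk_linear fL).
  have := cvg_comp _ _ F0 (fc 0); rewrite f0 => fF.
  have := (@sigma_cvgP R A Astar (fun a phi => pair a phi) (f @ F) 0 _).1 fF phi.
  by move=> h; rewrite /= f0; exact: h.
exists (\sum_(p <- r) p.1 *: p.2) => b; rewrite [RHS]rE linear_sum/=.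
by apply: eq_bigr => p _; rewrite linearZ.
Qed.

Lemma lact_exists : exists lact : A -> Astar -> Astar,
  forall a phi b, pair b (lact a phi) = pair (mul b a) phi.
Proof.
have /choice[g gP] : forall p : A * Astar, exists psi,
    forall b, pair b psi = pair (mul b p.1) p.2.
  move=> [a phi]; apply: weak_star_functional; last exact: dba_continuousl H a.
  exact: ba_linl (dba_algebra H) a.
by exists (fun a phi => g (a, phi)) => a phi b; rewrite gP.
Qed.

Lemma ract_exists a phi : exists psi, forall b, pair b psi = pair (mul a b) phi.
Proof.
apply: weak_star_functional; last exact: dba_continuousr H a.
exact: ba_linr (dba_algebra H) a.
Qed.

(** [lact a phi] is the module action [a . phi], the transpose of [b |-> b a]. *)
Section Unitization.
Variable lact : A -> Astar -> Astar.
Hypothesis lactE : forall a phi b, pair b (lact a phi) = pair (mul b a) phi.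

Let mulDr c a b : mul c (a + b) = mul c a + mul c b.
Proof. exact: (linearD (mk_linear (ba_linr (dba_algebra H) c))). Qed.

Let mulZr c k a : mul c (k *: a) = k *: mul c a.
Proof. by rewrite (scalable_linear (ba_linr (dba_algebra H) c)). Qed.

Lemma lact_linear a : linear (lact a).
Proof.
by move=> c phi psi; apply: pair_sep => b; rewrite lactE !linearP/= !lactE.
Qed.

Lemma lactD a b phi : lact (a + b) phi = lact a phi + lact b phi.
Proof.
apply: pair_sep => c; rewrite linearD/= !lactE.
by rewrite mulDr pairD.
Qed.

Lemma lactZ k a phi : lact (k *: a) phi = k *: lact a phi.
Proof.
apply: pair_sep => c; rewrite linearZ/= !lactE.
by rewrite mulZr pairZ.
Qed.

Lemma lactM a b phi : lact (mul a b) phi = lact a (lact b phi).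
Proof.
by apply: pair_sep => c; rewrite !lactE (ba_assoc (dba_algebra H)).
Qed.

Lemma rnorm_mul a b : rnorm (mul a b) <= rnorm a * rnorm b.
Proof.
by rewrite -lecR rmorphM/= !rnormE (ba_contractive (dba_algebra H)).
Qed.

Lemma rnorm_lact a phi : rnorm (lact a phi) <= rnorm a * rnorm phi.
Proof.
apply: pair_norming => [|b]; first by rewrite mulr_ge0 ?rnorm_ge0.
rewrite lactE (le_trans (pair_le _ _))// mulrAC.
by rewrite ler_wpM2r ?rnorm_ge0// mulrC rnorm_mul.
Qed.

(** The left action of [A] on the predual of its unitization: with elements of
    the unitization written [(b, s)], the formula for [L a] is the transpose of
    [(b, s) |-> (b, s) (a, 0) = (b a + s a, 0)].  The unit is what makes
    [<a, mu>] a matrix coefficient of [L a]. *)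
Lemma shift_exists : exists L : A -> bop X X,
  forall a (w : X), L a w = (lact a w.1, pair a w.1) :> X.
Proof.
suff : forall a, exists La : bop X X,
    forall w : X, La w = (lact a w.1, pair a w.1) :> X.
  by move=> /choice[L LP]; exists L.
move=> a.
have Ll : linear (fun w : X => (lact a w.1, pair a w.1) : X).
  move=> c u v; congr Datatypes.pair; first by rewrite /= lact_linear.
  by rewrite /= linearP.
have [|La LaE] := @bop_exists R X X (mk_linear Ll) (rnorm a).
  move=> w; rewrite rnorm_prod ge_max/=; apply/andP; split.
    by rewrite (le_trans (rnorm_lact _ _))// ler_wpM2l ?rnorm_ge0 ?rnorm_fst.
  by rewrite (le_trans (pair_le _ _))// ler_wpM2l ?rnorm_ge0 ?rnorm_fst.
by exists La.
Qed.

Section Shift.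
Variable L : A -> bop X X.
Hypothesis LE : forall a (w : X), L a w = (lact a w.1, pair a w.1) :> X.

Lemma shiftM a b w : L (mul a b) w = L a (L b w).
Proof. by rewrite !LE/= lactM lactE. Qed.

Lemma shift_linear w : linear (fun a => L a w).
Proof.
by move=> c a b; rewrite !LE pairD pairZ lactD lactZ.
Qed.

Lemma shift_le a w : rnorm (L a w) <= rnorm a * rnorm w.
Proof.
rewrite LE rnorm_prod ge_max/=; apply/andP; split.
  by rewrite (le_trans (rnorm_lact _ _))// ler_wpM2l ?rnorm_ge0 ?rnorm_fst.
by rewrite (le_trans (pair_le _ _))// ler_wpM2l ?rnorm_ge0 ?rnorm_fst.
Qed.

Lemma dual_unit_predual (G : dual X) : exists c s, forall w, G w = pair c w.1 + s * w.2.
Proof.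
have Gl : linear (fun phi : Astar => G ((phi, 0) : X)).
  move=> k u v; rewrite -linearP; congr (G _).
  by congr Datatypes.pair; rewrite /= scaler0 addr0.
have [|g gE] := @bop_exists R Astar R[i]^o (mk_linear Gl) (rnorm G).
  move=> phi; rewrite (le_trans (bop_le G _))// rnorm_prod/= rnorm0.
  by rewrite max_l ?rnorm_ge0.
have [c cg] := dba_surjective H g.
exists c, (G ((0, 1) : X)) => w; rewrite cg gE/= mulrC.
rewrite -/(w.2 *: (G ((0, 1) : X) : R[i]^o)) -linearZ -linearD; congr (G _).
case: w => u t; congr Datatypes.pair; rewrite /= ?scaler0 ?addr0// add0r.
by rewrite /GRing.scale/= mulr1.
Qed.

(** This is where both one-sided continuities of the product are needed: one
    gives [lact], the other the element [psi] of [Astar] representing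
    [b |-> <c b, m.1>]. *)
Lemma orbit_rep (xi : dual X) (m : X) :
  exists psi, forall b, pair b psi = xi (L b m).
Proof.
have [c [s xiE]] := dual_unit_predual xi.
have [psi psiE] := ract_exists c m.1.
exists (psi + s *: m.1) => b.
by rewrite xiE LE/= lactE linearD linearZ/= psiE.
Qed.

(** The transpose of the orbit map [(b, s) |-> L b m + s m] of the unitization,
    as a map into [X] instead of the dual of the unitization.  Since norms are
    dual to each other, [|T xi|] is the supremum of [xi] over the orbit of the
    unit ball. *)
Lemma orbit_exists (m : X) : exists T : bop (dual X) X, forall xi,
  (T xi).2 = xi m /\ forall b, pair b (T xi).1 = xi (L b m).
Proof.
have /choice[psi psiE] := orbit_rep ^~ m.
have Tl : linear (fun xi : dual X => (psi xi, xi m) : X).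
  move=> k u v; congr Datatypes.pair; apply: pair_sep => b /=.
  by rewrite linearP/= !psiE.
have [|T TE] := @bop_exists R (dual X) X (mk_linear Tl) (rnorm m).
  move=> xi; rewrite rnorm_prod ge_max/=; apply/andP; split.
    apply: pair_norming => [|b]; first by rewrite mulr_ge0 ?rnorm_ge0.
    rewrite psiE (le_trans (bop_le _ _))// -mulrA mulrCA.
    by rewrite ler_wpM2l ?rnorm_ge0// mulrC shift_le.
  by rewrite (le_trans (bop_le _ _))// mulrC.
by exists T => xi; rewrite TE/=; split=> // b; rewrite psiE.
Qed.

End Shift.
End Unitization.
End DualBanachAlgebra.

(** * The representation *)

Section InterpMap.
Variables (R : realType) (X : completeNormedModType R[i]) (J : choiceType).
Variable T : J -> bop (dual X) X.

Lemma interp_map (U : bop X X) (K : R) : 0 <= K ->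
  (forall i (xi eta : dual X), (forall v, eta v = xi (U v)) ->
    dual_weight T i eta <= K * dual_weight T i xi) ->
  exists V : 'B(interp T), rnorm V <= K /\ forall x j, V x j = U (x j).
Proof.
move=> K0 UK.
have UW i v : weight T i (U v) <= K * weight T i v.
  apply: weight_le => xi xi1; have [eta etaE] := bop_comp xi U.
  rewrite -etaE (le_trans (weight_ge T i v eta))// ler_wpM2r ?weight_ge0//.
  by rewrite (le_trans (UK _ _ _ etaE))// ler_piMr.
have Upn (x : interp T) s : partial_norm T s (fun j => U (x j)) <= K * partial_norm T s x.
  by rewrite -norm2Z//; apply: ler_norm2 => i; rewrite ?weight_ge0.
have Us (x : interp T) : (fun j => U (x j)) \in square_summable T.
  apply/asboolP; exists (K * rnorm x) => s us.
  by rewrite (le_trans (Upn _ _))// ler_wpM2l// partial_norm_le.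
have Vl : linear (fun x : interp T => Interp (Us x)).
  by move=> a x y; apply/val_inj/funext => j /=; rewrite linearP.
have VK (x : interp T) : rnorm (Interp (Us x)) <= K * rnorm x.
  apply: interp_norm_le => s us.
  by rewrite (le_trans (Upn _ _))// ler_wpM2l// partial_norm_le.
have [|V VE] := @bop_exists R (interp T) (interp T) (mk_linear Vl) K; first exact: VK.
exists V; split=> [|x j]; last by rewrite VE.
by apply: bop_norm_le => // x; rewrite VE; exact: VK.
Qed.

Lemma interp_op_ext (V W : 'B(interp T)) :
  (forall x j, V x j = W x j) -> V = W.
Proof. by move=> VW; do 2![apply/val_inj/funext => ?]; exact: VW. Qed.

End InterpMap.

Section Representation.
Variables (R : realType) (A Astar : completeNormedModType R[i]).
Variables (mul : A -> A -> A) (pair : A -> dual Astar).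
Hypothesis H : dual_banach_algebra mul pair.
Local Notation X := (unit_predual Astar).
Variable lact : A -> Astar -> Astar.
Hypothesis lactE : forall a phi b, pair b (lact a phi) = pair (mul b a) phi.
Variable L : A -> bop X X.
Hypothesis LE : forall a (w : X), L a w = (lact a w.1, pair a w.1) :> X.
Variable T : Astar -> bop (dual X) X.
Hypothesis T2 : forall mu xi, (T mu xi).2 = xi ((mu, 0) : X).
Hypothesis T1 : forall mu xi b, pair b (T mu xi).1 = xi (L b ((mu, 0) : X)).

(** The point is [(c, s) . m], where [(c, s)] is the element of the unitization
    that represents [G]. *)
Lemma orbit_weakly_compact mu (G : dual X) :
  exists y : X, forall xi, G (T mu xi) = xi y.
Proof.
have [c [s GE]] := dual_unit_predual H G.
exists (L c ((mu, 0) : X) + s *: ((mu, 0) : X)) => xi.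
by rewrite GE T1 T2 linearD linearZ.
Qed.

(** The orbit of the unit ball is mapped into [|a|] times itself by [L a]. *)
Lemma orbit_contraction a mu (xi eta : dual X) : (forall v, eta v = xi (L a v)) ->
  rnorm (T mu eta) <= rnorm a * rnorm (T mu xi).
Proof.
move=> etaE; rewrite rnorm_prod ge_max; apply/andP; split.
  apply: (pair_norming H) => [|b]; first by rewrite mulr_ge0 ?rnorm_ge0.
  rewrite T1 etaE -(shiftM H lactE LE) -T1 (le_trans (pair_le H _ _))//.
  rewrite mulrAC ler_pM ?rnorm_ge0 ?rnorm_fst//; exact: (rnorm_mul H).
rewrite T2 etaE -T1 (le_trans (pair_le H _ _))//.
by rewrite ler_wpM2l ?rnorm_ge0 ?rnorm_fst.
Qed.

Lemma dual_weight_shift a i (xi eta : dual X) : (forall v, eta v = xi (L a v)) ->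
  dual_weight T i eta <= rnorm a * dual_weight T i xi.
Proof.
move=> etaE; rewrite mulrDr; apply: lerD; rewrite mulrCA ler_wpM2l//.
- by rewrite exprn_ge0.
- exact: orbit_contraction.
- by rewrite invr_ge0 exprn_ge0.
apply: bop_norm_le => [|v]; first by rewrite mulr_ge0 ?rnorm_ge0.
rewrite etaE (le_trans (bop_le _ _))// (mulrC (rnorm a)) -mulrA.
by rewrite ler_wpM2l ?rnorm_ge0// (shift_le H lactE LE).
Qed.

Lemma rep_exists : exists pi : A -> 'B(interp T),
  (forall a, rnorm (pi a) <= rnorm a) /\
  forall a x j, pi a x j = L a (x j).
Proof.
have /choice[pi piP] : forall a, exists V : 'B(interp T),
    rnorm V <= rnorm a /\ forall x j, V x j = L a (x j).
  move=> a; apply: interp_map; first exact: rnorm_ge0.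
  by move=> i xi eta; exact: dual_weight_shift.
by exists pi; split=> a; case: (piP a).
Qed.

(** The generator [m = (mu, 0)] and the functional [(phi, t) |-> t] give the matrix
    coefficient [<a, mu>] of [L a].  At level [n] the first has weight at most
    [1 / c n] and the second has dual weight at most [c n].  As these bounds are
    inverse to each other, the coefficient is bounded by the norm of the
    representation with constant exactly [1]. *)
Section LowerBound.
Variable mu : Astar.
Hypothesis mu1 : rnorm mu <= 1.
Let m : X := (mu, 0).
Let c n : R := 2 ^+ n + 2 ^- n.

Let c_gt0 n : 0 < c n.
Proof. by rewrite addr_gt0 ?invr_gt0 ?exprn_gt0. Qed.

Let rnorm_m : rnorm m <= 1.
Proof. by rewrite rnorm_prod /= rnorm0 max_l ?rnorm_ge0. Qed.

Lemma weight_generator n : weight T (mu, n) m <= (c n)^-1.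
Proof.
apply: weight_le => xi xi1; rewrite -[leRHS]mulr1 ler_pdivlMl//.
apply: le_trans xi1; rewrite /dual_weight/= mulrDl lerD//.
  rewrite ler_wpM2l ?exprn_ge0// -T2; exact: rnorm_snd.
rewrite ler_wpM2l ?invr_ge0 ?exprn_ge0// (le_trans (bop_le _ _))//.
by rewrite ler_piMr ?rnorm_ge0 ?rnorm_m.
Qed.

Lemma snd_le_weight n (v : X) : cabs v.2 <= c n * weight T (mu, n) v.
Proof.
have el : linear (fun v : X => v.2 : R[i]^o) by [].
have [|e eE] := @bop_exists R X R[i]^o (mk_linear el) 1.
  by move=> w; rewrite mul1r; exact: rnorm_snd.
have e1 : rnorm e <= 1.
  by apply: bop_norm_le => // w; rewrite eE mul1r; exact: rnorm_snd.
have -> : v.2 = e v by rewrite eE.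
rewrite (le_trans (weight_ge T (mu, n) v e))// ler_wpM2r ?weight_ge0//.
rewrite /dual_weight/= /c lerD// ler_piMr ?invr_ge0 ?exprn_ge0//.
rewrite rnorm_prod ge_max; apply/andP; split.
  rewrite (_ : (T mu e).1 = mu)//; apply: (pair_sep H) => b.
  by rewrite T1 eE LE.
by rewrite T2 eE/= rnorm0.
Qed.

Let gen : Astar -> X := fun j => if j == mu then m else 0.

Let alpha n : R := (c n)^-1.
Let idx k : seq (Astar * nat) := [seq (mu, n) | n <- iota 0 k].

Let idx_uniq k : uniq (idx k).
Proof. by rewrite map_inj_uniq ?iota_uniq// => x y [->]. Qed.

Lemma gen_partial_norm s : uniq s ->
  exists k, partial_norm T s gen <= norm2 (idx k) (fun i => alpha i.2).
Proof.
move=> us; pose k := \max_(i <- s) i.2.+1; exists k.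
have alpha0 n : 0 <= alpha n by rewrite invr_ge0 ltW.
apply: norm2_le; first exact: norm2_ge0.
rewrite sqr_norm2; pose b (i : Astar * nat) := alpha i.2 ^+ 2.
apply: (le_trans _ (sum_mem_le (idx_uniq k) us (b := b) (fun=> sqr_ge0 _))).
rewrite [leRHS]big_mkcond/= big_seq [leRHS]big_seq; apply: ler_sum => -[j n] js.
case: ifPn => [/mapP[n' _ [-> ->]]|jn].
  rewrite ler_sqr ?nnegrE ?weight_ge0// /gen/= eqxx; exact: weight_generator.
have jmu : j != mu.
  apply: contraNneq jn => ->; apply/mapP; exists n => //.
  by rewrite mem_iota/= add0n /k; exact: (@leq_bigmax_seq _ s xpredT (fun i => i.2.+1) _ js).
rewrite /= /gen (negPf jmu) (_ : weight T (j, n) 0 = 0) ?expr0n//.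
apply/eqP; rewrite eq_le weight_ge0 andbT.
by rewrite (le_trans (weight_le_rnorm _ _ _))// rnorm0 mulr0.
Qed.

Lemma alpha_bounded k : norm2 (idx k) (fun i => alpha i.2) <= 2.
Proof.
have alpha0 n : 0 <= alpha n by rewrite invr_ge0 ltW.
rewrite (le_trans (norm2_sum _ _))// big_map /=.
have -> : \sum_(n <- iota 0 k) alpha n = \sum_(n < k) alpha n.
  by rewrite -(big_mkord xpredT alpha) /index_iota subn0.
apply: (@le_trans _ _ (2 - 2 * 2 ^- k)); last by rewrite gerBl mulr_ge0// invr_ge0 exprn_ge0.
elim: k => [|k IH]; first by rewrite big_ord0 expr0 invr1 mulr1 subrr.
rewrite big_ord_recr/=; have a2 : alpha k <= 2 ^- k.
  by rewrite /alpha lef_pV2 ?posrE ?exprn_gt0// lerDl invr_ge0 exprn_ge0.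
have -> : 2 ^- k.+1 = 2 ^- k / 2 :> R by rewrite exprS invfM mulrC.
by move: IH a2; set w := 2 ^- k; lra.
Qed.

Lemma rep_lower_bound (V : 'B(interp T)) a :
  (forall x j, V x j = L a (x j)) -> cabs (pair a mu) <= rnorm V.
Proof.
move=> VE; have genE : gen \in square_summable T.
  apply/asboolP; exists 2 => s us; have [k /le_trans] := gen_partial_norm us.
  by apply; exact: alpha_bounded.
pose M := Interp genE.
have step k : cabs (pair a mu) * norm2 (idx k) (fun i => alpha i.2) <= rnorm V * rnorm M.
  rewrite (le_trans _ (bop_le V M))//.
  rewrite (le_trans _ (partial_norm_le (V M) (idx_uniq k)))//.
  rewrite -norm2Z ?cabs_ge0//; apply: norm2_le; first exact: norm2_ge0.
  rewrite sqr_norm2 !big_map; apply: ler_sum => n _ /=.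
  rewrite ler_sqr ?nnegrE ?mulr_ge0 ?cabs_ge0 ?invr_ge0 ?weight_ge0 ?(ltW (c_gt0 _))//.
  rewrite mulrC ler_pdivrMl// VE/= /gen eqxx.
  by have := snd_le_weight n (L a m); rewrite LE.
have [M0|M0] := eqVneq (rnorm M) 0.
  have : rnorm (M mu) = 0 by rewrite (rnorm_eq0 M0) rnorm0.
  rewrite /= /gen eqxx => /rnorm_eq0 mE.
  have -> : mu = 0 by have := congr1 fst mE.
  by rewrite linear0 (_ : cabs _ = 0) ?cabs0// rnorm_ge0.
have Mp : 0 < rnorm M by rewrite lt_neqAle eq_sym M0 rnorm_ge0.
have [->|p0] := eqVneq (cabs (pair a mu)) 0; first exact: rnorm_ge0.
have pp : 0 < cabs (pair a mu) by rewrite lt_neqAle eq_sym p0 cabs_ge0.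
rewrite -(ler_pM2r Mp) -ler_pdivlMl//.
apply: interp_norm_le => s us; have [k sk] := gen_partial_norm us.
by rewrite (le_trans sk)// ler_pdivlMl.
Qed.

End LowerBound.

Lemma rep_isometric (pi : A -> 'B(interp T)) :
  (forall a, rnorm (pi a) <= rnorm a) ->
  (forall a x j, pi a x j = L a (x j)) ->
  forall a, `|pi a| = `|a|.
Proof.
move=> pi1 piE a; rewrite -!rnormE; congr (_%:C); apply/eqP; rewrite eq_le pi1/=.
rewrite -(rnorm_pair H); apply: opnorm_lub => mu; rewrite -(rnorm_le _ 1) => mu1.
exact: (rep_lower_bound mu1 (piE a)).
Qed.

End Representation.

(** * Weak-star continuity *)

Section TraceBound.
Variables (R : realType) (E : normedModType R[i]).
Implicit Types (s : tensor_rep (dual E) E) (V : 'B(E)).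

Definition trace_form V : dual E -> E -> R[i]^o := fun f x => f (V x).

Let trace_form_l V x : linear (trace_form V ^~ x). Proof. by []. Qed.
Let trace_form_r V f : linear (trace_form V f).
Proof. by move=> a x y; rewrite /trace_form !linearP. Qed.

HB.instance Definition _ V := @bilinear_isBilinear.Build R[i] (dual E) E R[i]^o
  *:%R *:%R (trace_form V) (conj (trace_form_l V) (trace_form_r V)).

Definition trace_sum V s : R[i]^o := \sum_(p <- s) p.1 (V p.2).

(** Equal tensors have equal trace sums, so the bound by the sum of the products
    of norms may be taken over all representations of the tensor. *)
Lemma trace_sum_le V s : cabs (trace_sum V s) <= rnorm V * proj_norm s.
Proof.
have [V0|V0] := eqVneq (rnorm V) 0.
  rewrite V0 mul0r /trace_sum big1 ?cabs0// => p _.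
  by rewrite (rnorm_eq0 V0) linear0.
have Vp : 0 < rnorm V by rewrite lt_neqAle eq_sym V0 rnorm_ge0.
rewrite -ler_pdivrMl//; apply: lb_le_inf.
  by exists (\sum_(p <- s) rnorm p.1 * rnorm p.2), s.
move=> _ [t /= st <-]; rewrite ler_pdivrMl//.
have -> : trace_sum V s = trace_sum V t by exact: (st _ (trace_form V)).
rewrite (le_trans (cabs_sum _ _))// mulr_sumr; apply: ler_sum => p _.
rewrite (le_trans (bop_le _ _))// mulrCA ler_wpM2l ?rnorm_ge0//; exact: bop_le.
Qed.

Lemma trace_sum_sub V s t :
  trace_sum V (tensor_sub s t) = trace_sum V s - trace_sum V t.
Proof.
rewrite /trace_sum /tensor_sub big_cat/= big_map; congr (_ + _).
by rewrite -sumrN; apply: eq_bigr.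
Qed.

(** The approximation is uniform on bounded sets of operators, because the Cauchy
    condition on [u] does not involve the operator. *)
Lemma trace_pairing_approx (u : proj_tensor (dual E) E) (e : R) : 0 < e ->
  exists n, forall V, cabs (trace_pairing V u - trace_sum V (u n)) <= e * rnorm V.
Proof.
case: u => u uC e0; have [N NP] := uC _ e0; exists N => V /=.
have tC m n (d : R) : proj_norm (tensor_sub (u m) (u n)) < d ->
    cabs (trace_sum V (u m) - trace_sum V (u n)) <= rnorm V * d.
  move=> h; rewrite -trace_sum_sub (le_trans (trace_sum_le _ _))//.
  by rewrite ler_wpM2l ?rnorm_ge0// ltW.
have : cvg ((fun n => trace_sum V (u n)) @ \oo).
  apply: complex_complete; apply/norm_cauchyP => d d0.
  have den : 0 < rnorm V + 1 by rewrite ltr_wpDl ?rnorm_ge0.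
  have [M MP] := uC _ (divr_gt0 d0 den); exists (trace_sum V (u M)), M => //= n Mn.
  apply: le_lt_trans (tC _ _ _ (MP M n (leqnn M) Mn)) _.
  by rewrite mulrCA gtr_pMr// ltr_pdivrMr// mul1r ltrDl.
move=> /cvg_ex[l ul]; have -> : trace_pairing V (ProjTensor uC) = l.
  apply: cvg_lim ul; exact: norm_hausdorff.
apply/ler_addgt0Pl => d d0.
have [M _ MP] := (norm_cvgP _ _ _).1 ul d d0.
pose n := maxn M N.
have h1 : cabs (l - trace_sum V (u n)) < d by exact: (MP n (leq_maxl _ _)).
have h2 := tC n N _ (NP n N (leq_maxr _ _) (leqnn N)).
have -> : l - trace_sum V (u N) =
  (l - trace_sum V (u n)) + (trace_sum V (u n) - trace_sum V (u N)) by ring.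
by rewrite (le_trans (cabsD _ _))// lerD ?(ltW h1)// mulrC.
Qed.

End TraceBound.

Section WeakStarContinuity.
Variables (R : realType) (A Astar : completeNormedModType R[i]).
Variables (mul : A -> A -> A) (pair : A -> dual Astar).
Hypothesis H : dual_banach_algebra mul pair.
Local Notation X := (unit_predual Astar).

Definition in_predual (psi : A -> R[i]) := exists phi, forall a, psi a = pair a phi.

Lemma in_predual_sum (I : Type) (r : seq I) (psi : I -> A -> R[i]) :
  (forall i, in_predual (psi i)) -> in_predual (fun a => \sum_(i <- r) psi i a).
Proof.
move=> h; have [phi phiE] := choice h; exists (\sum_(i <- r) phi i) => a.
by rewrite linear_sum/=; apply: eq_bigr.
Qed.

Lemma in_predual_closed (psi : A -> R[i]) :
  (forall e : R, 0 < e -> exists2 chi, in_predual chi &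
    forall a, cabs (psi a - chi a) <= e * rnorm a) ->
  in_predual psi.
Proof.
move=> h; have /choice[inv invE] := dba_surjective H.
have inj a b : pair a = pair b -> a = b.
  move=> ab; apply/subr0_eq/rnorm_eq0; rewrite -(rnorm_pair H).
  have -> : pair (a - b) = 0; last exact: rnorm0.
  by have -> : pair (a - b) = pair a - pair b :=
    linearB (mk_linear (dba_linear H)) a b; rewrite ab subrr.
have [e e0|phi phiE] := @bidual_closed R Astar (fun g => psi (inv g)).
  have [chi [phi phiE] chie] := h e e0; exists phi => g.
  by rewrite -{2}(invE g) -phiE (le_trans (chie _))// -(rnorm_pair H) invE.
by exists phi => a; rewrite -phiE; congr psi; apply: inj; rewrite invE.
Qed.

Variable lact : A -> Astar -> Astar.
Hypothesis lactE : forall a phi b, pair b (lact a phi) = pair (mul b a) phi.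
Variable L : A -> bop X X.
Hypothesis LE : forall a (w : X), L a w = (lact a w.1, pair a w.1) :> X.
Variable T : Astar -> bop (dual X) X.
Variable pi : A -> 'B(interp T).
Hypothesis pi1 : forall a, rnorm (pi a) <= rnorm a.
Hypothesis piE : forall a x j, pi a x j = L a (x j).

(** True for coordinate functionals by [orbit_rep]; the general case follows by
    density, since the predual is norm closed in the dual of [A]. *)
Lemma coefficient_in_predual (f : dual (interp T)) x : in_predual (fun a => f (pi a x)).
Proof.
apply: in_predual_closed => e e0.
have d0 : 0 < e / (rnorm x + 1) by rewrite divr_gt0// ltr_wpDl ?rnorm_ge0.
have [r rP] := coord_dense f d0.
exists (fun a => \sum_(p <- r) p.2 (L a (x p.1))).
  apply: in_predual_sum => p; have [phi phiE] := orbit_rep H lactE LE p.2 (x p.1).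
  by exists phi => a; rewrite phiE.
move=> a; under eq_bigr do rewrite -piE.
rewrite (le_trans (rP _))// -mulrA ler_wpM2l ?(ltW e0)//.
rewrite ler_pdivrMl ?ltr_wpDl ?rnorm_ge0//.
rewrite (le_trans (bop_le _ _))// mulrC ler_pM ?rnorm_ge0//.
by rewrite lerDl.
Qed.

Lemma trace_in_predual u : in_predual (fun a => trace_pairing (pi a) u).
Proof.
apply: in_predual_closed => e e0; have [n nP] := trace_pairing_approx u e0.
exists (fun a => trace_sum (pi a) (u n)).
  by apply: in_predual_sum => p; exact: coefficient_in_predual.
by move=> a; rewrite (le_trans (nP _))// ler_wpM2l// ltW.
Qed.

Lemma rep_weak_star_continuous :
  continuous (pi : weak_star pair -> weak_star_op (interp T)).
Proof.
move=> a.
apply: (@sigma_cvgP R 'B(interp T) _ (@trace_pairing R (interp T)) (pi @ nbhs (a : weak_star pair)) (pi a) _).2 => u.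
have [phi phiE] := trace_in_predual u.
have FF : Filter (nbhs (a : weak_star pair)) by exact: nbhs_filter.
have h := (@sigma_cvgP R A Astar (fun a phi => pair a phi) (nbhs (a : weak_star pair)) a FF).1 (@cvg_id _ _) phi.
have -> : trace_pairing (pi a) u = pair a phi by exact: phiE.
suff : (fun b => trace_pairing (pi b) u : R[i]^o) @ nbhs (a : weak_star pair)
    --> (pair a phi : R[i]^o) by [].
have -> : (fun b => trace_pairing (pi b) u) = (fun b => pair b phi).
  by apply/funext => b; exact: phiE.
exact: h.
Qed.

End WeakStarContinuity.

Theorem corollary3p8 (R : realType) (A Astar : completeNormedModType R[i])
    (mul : A -> A -> A) (pair : A -> dual Astar) :
  dual_banach_algebra mul pair ->
  exists (E : completeNormedModType R[i]) (pi : A -> 'B(E)),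
    [/\ reflexive_space E,
        linear pi,
        forall a b, pi (mul a b) = pi a \o pi b :> (E -> E),
        forall a, `|pi a| = `|a| &
        continuous (pi : weak_star pair -> weak_star_op E)].
Proof.
move=> H; have [lact lactE] := lact_exists H.
have [L LE] := shift_exists H lactE.
have [T TP] := choice (fun mu => orbit_exists H lactE LE ((mu, 0) : unit_predual Astar)).
have T2 mu xi : (T mu xi).2 = xi ((mu, 0) : unit_predual Astar) by case: (TP mu xi).
have T1 mu xi b : pair b (T mu xi).1 = xi (L b ((mu, 0) : unit_predual Astar)).
  by case: (TP mu xi).
have [pi [pi1 piE]] := rep_exists H lactE LE T2 T1.
exists (interp T : completeNormedModType R[i]), pi; split.
- apply: interp_reflexive; exact: (orbit_weakly_compact H T2 T1).
- move=> c a b; apply: interp_op_ext => x j.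
  rewrite bopDE bopZE interpDE interpZE !piE.
  exact: (shift_linear H lactE LE).
- move=> a b; apply/funext => x; apply/val_inj/funext => j.
  have -> : val (pi (mul a b) x) j = L (mul a b) (x j) by exact: piE.
  by rewrite (shiftM H lactE LE) -!piE.
- exact: (rep_isometric H LE T2 T1 pi1 piE).
- exact: (rep_weak_star_continuous H lactE LE pi1 piE).
Qed.
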